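(* Suppose that there are constants $J\in[0,\infty)$ and $K,L,\mathcal R\in(0,\infty)$ such that (C1) $(x-y)\cdot(b(x)-b(y))\le J|x-y|^2$ for any $x,y\in\mathbb{R}^d$, (C2) $(x-y)\cdot(b(x)-b(y))\le-K|x-y|^2$ if $|x-y|\ge\mathcal R$, (C3) $|b(x)-b(y)|\le L|x-y|$ for any $x,y\in\mathbb{R}^d$. Let $\Lambda=\min(L,J+L^2h/2)$, $r_1=(1+hL)\mathcal R$, $q=7c_0^{-1}\Lambda\mathcal R$, and $$\rho(x,y)=f(|x-y|),\qquad f(r)=\int_0^r\exp(-q(s\wedge r_1))\,ds.$$ Let $$c_2=\min\left(\frac K2,\ \frac{245}{24c_0}\Lambda^2\mathcal R^2\right)\exp\left(-\frac{49}{6c_0}\Lambda\mathcal R^2\right),$$ $$h_0=\frac1L\min\left(\frac16,\ \frac KL,\ \frac13L\mathcal R^2,\ \frac{c_0^2}{970}\,\frac1{L\mathcal R^2}\right).$$ Then $$\mathbb{E}_{x,y}[\rho(X',Y')]\le(1-c_2h)\,\rho(x,y)\quad\text{for any }x,y\in\mathbb{R}^d\text{ and }h\in(0,h_0].$$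
   Context: $b:\mathbb{R}^d\to\mathbb{R}^d$ is a Lipschitz continuous vector field and $h>0$ a step size. For $x\in\mathbb{R}^d$ let $\hat x=x+hb(x)$. The Euler transition kernel is $p(x,\cdot)=N(\hat x,hI_d)$; $\phi_{m,hI}$ denotes the density of $N(m,hI_d)$. The quantities $\Lambda,r_1,q,f,\rho,c_2$ depend on $h$. Coupling: for $x,y\in\mathbb{R}^d$ let $\hat e=(\hat x-\hat y)/|\hat x-\hat y|$ if $\hat x\ne\hat y$ and $\hat e=0$ otherwise. Under $\mathbb{P}_{x,y}$, let $Z\sim N(0,I_d)$ and $U\sim\mathrm{Unif}(0,1)$ be independent, and $$X'=\hat x+\sqrt h\,Z,\qquad Y'=\begin{cases}X'&\text{if }U\le\phi_{\hat y,hI}(X')/\phi_{\hat x,hI}(X'),\\ \hat y+\sqrt h\,(I_d-2\hat e\hat e^T)Z&\text{otherwise.}\end{cases}$$ Universal constant (with $\phi$ the standard normal density on $\mathbb{R}$): $$c_0=4\min\left(\int_0^{1/2}u^2(1-e^{u-1/2})\phi(u)\,du,\ (1-e^{-1})\int_0^{1/2}u^3\phi(u)\,du\right)\ge0.007.$$ *)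

(* Defs.v *)
From HB Require Import structures.
From mathcomp Require Import all_boot all_order all_algebra.
From mathcomp Require Import all_classical all_reals all_analysis.

Set Implicit Arguments.
Unset Strict Implicit.
Unset Printing Implicit Defensive.

Import Order.TTheory GRing.Theory Num.Theory.
Import numFieldNormedType.Exports.

Local Open Scope classical_set_scope.
Local Open Scope ring_scope.

Definition dotv (R : realType) (d : nat) (u v : 'cV[R]_d) : R :=
  \sum_(i < d) u i 0 * v i 0.

(* The Euclidean norm: the library norm on matrices is the sup norm. *)
Definition enorm (R : realType) (d : nat) (u : 'cV[R]_d) : R :=
  Num.sqrt (dotv u u).

Definition col_of_tuple (R : realType) (d : nat) (z : d.-tuple R) : 'cV[R]_d :=
  \col_i tnth z i.

(* The law of Z is N(0, I_d), the d-fold product of N(0, 1), which is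
   determined by its values on measurable boxes. *)
Definition std_gaussian_vector (disp : measure_display)
    (T : measurableType disp) (R : realType) (P : probability T R) (d : nat)
    (Z : {RV P >-> d.-tuple R}) : Prop :=
  forall A : 'I_d -> set R, (forall i, measurable (A i)) ->
    distribution P Z [set z | forall i, A i (tnth z i)] =
    (\prod_(i < d) normal_prob 0 1 (A i))%E.

Definition uniform01 (disp : measure_display)
    (T : measurableType disp) (R : realType) (P : probability T R)
    (U : {RV P >-> R}) : Prop :=
  forall B : set R, measurable B ->
    distribution P U B = uniform_prob (@ltr01 R) B.

Definition independent_RV (disp disp1 disp2 : measure_display)
    (T : measurableType disp) (T1 : measurableType disp1)
    (T2 : measurableType disp2) (R : realType) (P : probability T R)
    (X : {RV P >-> T1}) (Y : {RV P >-> T2}) : Prop :=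
  forall (A : set T1) (B : set T2), measurable A -> measurable B ->
    P (X @^-1` A `&` Y @^-1` B) = (P (X @^-1` A) * P (Y @^-1` B))%E.

(* Density of N(m, h I_d); the second parameter of normal_pdf is the standard
   deviation. *)
Definition gaussian_pdf (R : realType) (d : nat) (m : 'cV[R]_d) (h : R)
    (z : 'cV[R]_d) : R :=
  \prod_(i < d) normal_pdf (m i 0) (Num.sqrt h) (z i 0).

Section euler_coupling.
Variables (R : realType) (d : nat) (b : 'cV[R]_d -> 'cV[R]_d) (h : R).

Definition euler_drift (x : 'cV[R]_d) : 'cV[R]_d := x + h *: b x.

Definition unit_direction (u v : 'cV[R]_d) : 'cV[R]_d :=
  if u == v then 0 else (enorm (u - v))^-1 *: (u - v).

Definition coupling_X (x z : 'cV[R]_d) : 'cV[R]_d :=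
  euler_drift x + Num.sqrt h *: z.

Definition coupling_Y (x y z : 'cV[R]_d) (u : R) : 'cV[R]_d :=
  let X' := coupling_X x z in
  let e := unit_direction (euler_drift x) (euler_drift y) in
  if u <= gaussian_pdf (euler_drift y) h X' / gaussian_pdf (euler_drift x) h X'
  then X'
  else euler_drift y + Num.sqrt h *: ((1%:M - 2 *: (e *m e^T)) *m z).

End euler_coupling.

Definition c0 (R : realType) : R :=
  4 * Num.min
    (\int[lebesgue_measure]_(u in `[0, 2^-1])
       (u ^+ 2 * (1 - expR (u - 2^-1)) * normal_pdf 0 1 u))
    ((1 - expR (-1)) *
     \int[lebesgue_measure]_(u in `[0, 2^-1]) (u ^+ 3 * normal_pdf 0 1 u)).

(* Main.v *)
Require Import Defs.
From HB Require Import structures.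
From mathcomp Require Import all_boot all_order all_algebra ring lra.
From mathcomp Require Import all_classical all_reals all_analysis.
From mathcomp Require Import measurable_realfun.

(** The two coupled chains differ by a random multiple of the unit vector [e]
    that joins the drifted points, and this multiple depends on the noise only
    through [w = e . Z] and the uniform variable.  With [rh] the distance of the
    drifted points and [s = rh / sqrt h], the new distance is 0 if the uniform
    variable is at most [expR (- (s * w) - s ^+ 2 / 2)], and
    [|rh + 2 * sqrt h * w|] otherwise ([coupled_distanceE]).  Since [Z] is a
    standard Gaussian vector, [w] is a standard normal variable independent of
    the uniform one ([partial_dot_law], [joint_law]), so that every expectation
    is a one-dimensional Gaussian integral weighted by the rejection probability
    ([integral_rejection]).

    The distance is preserved in mean ([mean_reflection]).  As [f] is concave, its
    tangent at [rh] shows that the expectation of [f] at the new distance is at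
    most [f rh].  The curvature [f'' = - q * f'] improves this: on a window of
    width [sqrt h] next to [rh] the tangent inequality gains a multiple of the
    squared increment ([profile_gain_left], [profile_gain_right]), and the
    expectation of the squared increment over the rejections in that window is at
    least [h * c0 * min s 1] ([far_gain], [near_gain]); this is what the constant
    [c0] measures.  The window lies below [rh] if [s] is at least 1 and above it
    otherwise, since two strongly overlapping laws leave no mass below.  The
    combination is [expected_profile_le].

    It remains to compare [f rh] with [f r], where [r] is the initial distance.
    If [r] is at least [Rad], the drift contracts distances by [1 - h * K / 2] and
    concavity of [f] suffices ([contraction_large]).  Otherwise [rh] is at most
    [(1 + h * Lam) * r], so the drift costs at most [f' r * h * Lam * r]; the
    choice of [q] makes the curvature gain larger than this cost, with a surplus
    that exceeds [c2 * h * f r] ([contraction_far], [contraction_near]).  The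
    restriction [h * L ^+ 2 <= K] makes the drift contract outside the ball; the
    other restrictions on the step size keep [q * sqrt h] below 1/4 and [rh]
    comparable with [r], so that the slope hardly changes over one step. *)

Set Implicit Arguments.
Unset Strict Implicit.
Unset Printing Implicit Defensive.

Import Order.TTheory GRing.Theory Num.Theory.
Import numFieldNormedType.Exports.

Local Open Scope classical_set_scope.
Local Open Scope ring_scope.

(** * Elementary bounds for the exponential *)
Section exponential_bounds.
Variable R : realType.
Implicit Types x z : R.

(** Here and in the next lemma the tangent bound is applied at a quarter of the
    exponent and raised to the fourth power: no power series is needed, at the
    price of 3/8 and 35/100 in place of the Taylor coefficient 1/2. *)
Lemma expR_ge_quadratic z : 0 <= z -> 1 + z + 3 / 8 * z ^+ 2 <= expR z.
Proof.
move=> z0; have h := expR_ge1Dx (z / 4).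
have -> : z = 4%:R * (z / 4) by field.
rewrite expRM_natl; apply: (@le_trans _ _ ((1 + z / 4) ^+ 4)); last first.
  by rewrite ler_pXn2r ?nnegrE ?expR_ge0//; lra.
rewrite -subr_ge0 (_ : _ - _ = z ^+ 3 / 16 + z ^+ 4 / 256); last by field.
by rewrite addr_ge0 ?mulr_ge0 ?exprn_ge0 ?invr_ge0 ?ler0n.
Qed.

Lemma expRN_ge_quadratic z : 0 <= z -> z <= 1 / 4 ->
  1 - z + (35 / 100) * z ^+ 2 <= expR (- z).
Proof.
move=> z0 z1; have h := expR_ge1Dx (- z / 4).
have -> : - z = 4%:R * (- z / 4) by field.
rewrite expRM_natl; apply: (@le_trans _ _ ((1 + - z / 4) ^+ 4)); last first.
  by rewrite ler_pXn2r ?nnegrE ?expR_ge0//; lra.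
rewrite -subr_ge0.
rewrite (_ : _ - _ = z ^+ 2 * (25 / 1000 - z / 16 + z ^+ 2 / 256)); last by field.
by apply: mulr_ge0; [exact: sqr_ge0|nra].
Qed.

Lemma expRN_le_affine z : 0 <= z -> z <= 1 / 4 -> expR (- z) <= 1 - 3 / 4 * z.
Proof.
move=> z0 z1; have h := expR_ge1Dx z.
rewrite expRN.
have p : 0 < 1 + z by lra.
apply: (@le_trans _ _ (1 + z)^-1); first by rewrite lef_pV2 ?posrE ?expR_gt0.
rewrite -div1r ler_pdivrMr//.
have : 0 <= z * (1 / 4 - z) by rewrite mulr_ge0//; lra.
by lra.
Qed.

Lemma mulr_expRN_le_half z : z * expR (- z) <= 2^-1.
Proof.
have [z0|z0] := leP z 0.
  apply: (@le_trans _ _ 0); last by rewrite invr_ge0.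
  by apply: mulr_le0_ge0 => //; exact: expR_ge0.
rewrite expRN ler_pdivrMr ?expR_gt0//.
have := expR_ge_quadratic (ltW z0).
have := sqr_ge0 (z - 4 / 3).
by rewrite !expr2; lra.
Qed.

End exponential_bounds.

(** * The concave distance profile *)
Section profile.
Variables (R : realType) (q a : R).
Hypotheses (q0 : 0 < q) (a0 : 0 <= a).
Implicit Types r u v : R.

Let q_neq0 : q != 0. Proof. by rewrite gt_eqF. Qed.

(** The derivative of the distance function [f] for which the coupling
    contracts, with [a] in the role of [r1]. *)
Definition slope r := expR (- (q * Num.min r a)).

(** Closed form of the primitive of [slope] vanishing at 0.  It is handier than
    the integral: convexity estimates become estimates on [expR], and no case
    distinction at the kink is needed to state them. *)
Definition profile r :=
  (1 - slope r) / q + (r - Num.min r a) * slope r.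

Lemma slope_gt0 r : 0 < slope r. Proof. exact: expR_gt0. Qed.

Lemma profile_small r : r <= a -> profile r = (1 - expR (- (q * r))) / q.
Proof. by move=> ra; rewrite /profile /slope min_l// subrr mul0r addr0. Qed.

Lemma profile_large r : a <= r -> profile r = profile a + (r - a) * slope a.
Proof. by move=> ar; rewrite /profile /slope minxx min_r// subrr mul0r addr0. Qed.

Lemma profile0 : profile 0 = 0.
Proof. by rewrite profile_small// mulr0 oppr0 expR0 subrr mul0r. Qed.

Lemma profile_tangent_small u v : u <= a -> v <= a ->
  profile v <= profile u + slope u * (v - u).
Proof.
move=> ua va; rewrite !profile_small// /slope min_l//.
have -> : expR (- (q * v)) = expR (- (q * u)) * expR (- (q * (v - u))).
  by rewrite -expRD; congr expR; ring.
have := expR_ge1Dx (- (q * (v - u))); have := expR_gt0 (- (q * u)).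
set E := expR (- (q * u)); set G := expR _ => E0 G1.
rewrite -subr_ge0.
rewrite (_ : _ - _ = E * (G - (1 + - (q * (v - u)))) / q); last by field.
by rewrite mulr_ge0 ?invr_ge0 ?(ltW q0)// mulr_ge0 ?(ltW E0)// subr_ge0.
Qed.

Lemma slope_anti u v : u <= v -> slope v <= slope u.
Proof.
move=> uv; rewrite ler_expR lerN2 ler_pM2l// le_min !ge_min lexx uv orbT.
by [].
Qed.

(** Concavity, in the form in which it is used: the graph lies below each of its
    tangents, also across the kink. *)
Lemma profile_tangent u v : profile v <= profile u + slope u * (v - u).
Proof.
have aa : slope a = slope (Num.max a u) by rewrite /slope minxx min_r// le_max lexx.
have [ua|au] := leP u a; have [va|av] := leP v a.
- exact: profile_tangent_small.
- rewrite profile_large; last exact: ltW.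
  have h := profile_tangent_small ua (lexx a).
  have := slope_anti ua; have : 0 <= v - a by lra.
  by nra.
- rewrite (@profile_large u); last exact: ltW.
  have h := profile_tangent_small (lexx a) va.
  have -> : slope u = slope a by rewrite /slope minxx min_r// ltW.
  by nra.
- rewrite (profile_large (ltW av)) (profile_large (ltW au)).
  have -> : slope u = slope a by rewrite /slope minxx min_r// ltW.
  by nra.
Qed.

Lemma profile_le_id r : profile r <= r.
Proof.
have := profile_tangent 0 r.
by rewrite profile0 /slope min_l// mulr0 oppr0 expR0 mul1r add0r addr0.
Qed.

Lemma slope_mul_le_profile r : slope r * r <= profile r.
Proof. by have := profile_tangent r 0; rewrite profile0; lra. Qed.

Lemma profile_ge0 r : 0 <= r -> 0 <= profile r.
Proof.
by move=> r0; apply: le_trans (slope_mul_le_profile r); rewrite mulr_ge0 ?(ltW (slope_gt0 _)).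
Qed.

(** Strict concavity below the kink improves the tangent inequality by a
    quadratic term, because [slope] solves [slope' = - q * slope] there.  To the
    left of [u] the slope only increases, so there is no size restriction. *)
Lemma profile_gain_left u v : u <= a -> v <= u ->
  profile v + 3 / 8 * q * slope u * (v - u) ^+ 2 <= profile u + slope u * (v - u).
Proof.
move=> ua vu; have va := le_trans vu ua.
rewrite !profile_small// /slope min_l//.
have -> : expR (- (q * v)) = expR (- (q * u)) * expR (q * (u - v)).
  by rewrite -expRD; congr expR; ring.
have z0 : 0 <= q * (u - v) by rewrite mulr_ge0 ?(ltW q0)// subr_ge0.
have := expR_ge_quadratic z0; have := expR_gt0 (- (q * u)).
set E := expR (- (q * u)); set G := expR _ => E0 G1.
rewrite -subr_ge0.
rewrite (_ : _ - _ = E * (G - (1 + q * (u - v) + 3 / 8 * (q * (u - v)) ^+ 2)) / q);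
  last by field.
by rewrite mulr_ge0 ?invr_ge0 ?(ltW q0)// mulr_ge0 ?(ltW E0)// subr_ge0.
Qed.

(** To the right of [u] two effects weaken the quadratic term: the slope
    decreases, which is harmless on distances below [1 / (4 * q)], and [v] may
    lie beyond the kink.  It is enough that half of the segment from [u] to [v]
    lies before the kink: the part [m] before it contributes a square, and the
    slope lost there is lost on all of the remaining part [v - u - m]. *)
Lemma profile_gain_right u v : u <= a -> u <= v -> v - u <= 2 * (a - u) ->
  q * (v - u) <= 1 / 4 ->
  profile v + 1 / 4 * q * slope u * (v - u) ^+ 2 <= profile u + slope u * (v - u).
Proof.
move=> ua uv h1 h2.
pose m := Num.min v a - u.
have m0 : 0 <= m by rewrite subr_ge0 le_min uv ua.
have mv : m <= v - u by rewrite lerD2r ge_min lexx.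
have mh : v - u <= 2 * m.
  by rewrite /m; case: (leP v a) => va; lra.
have Ev : slope v = slope u * expR (- (q * m)).
  by rewrite /slope -expRD (min_l ua) /m; congr expR; ring.
have -> : profile v = profile u + slope u *
   ((1 - expR (- (q * m))) / q + (v - u - m) * expR (- (q * m))).
  rewrite {1}/profile (profile_small ua) Ev (_ : slope u = expR (- (q * u))); last first.
    by rewrite /slope min_l.
  by rewrite /m; field.
have E0 := slope_gt0 u.
suff : (1 - expR (- (q * m))) / q + (v - u - m) * expR (- (q * m)) +
     1 / 4 * q * (v - u) ^+ 2 <= v - u.
  by nra.
set y := v - u in h2 mv mh *.
have qm0 : 0 <= q * m by rewrite mulr_ge0// ltW.
have qm1 : q * m <= 1 / 4 by apply: le_trans h2; rewrite ler_pM2l.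
have e1 := expRN_ge_quadratic qm0 qm1.
have e2 := expRN_le_affine qm0 qm1.
have {e1} : (1 - expR (- (q * m))) / q <= m - 35 / 100 * q * m ^+ 2.
  rewrite ler_pdivrMr//; set E := expR _ in e1 *.
  by rewrite (_ : _ * q = q * m - 35 / 100 * (q * m) ^+ 2); [lra|ring].
have {e2} : (y - m) * expR (- (q * m)) <= (y - m) * (1 - 3 / 4 * (q * m)).
  by rewrite ler_wpM2l// subr_ge0.
have : 0 <= q * (35 / 100 * m ^+ 2 + 3 / 4 * m * (y - m) - 1 / 4 * y ^+ 2).
  by rewrite mulr_ge0 ?(ltW q0)//; nra.
by nra.
Qed.

End profile.

(** * The profile as an integral *)
Section profile_integral.
Variables (R : realType) (q a : R).
Hypotheses (q0 : 0 < q) (a0 : 0 <= a).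

Let q_neq0 : q != 0. Proof. by rewrite gt_eqF. Qed.

Lemma continuous_slope : continuous (slope q a).
Proof.
move=> x; apply: continuous_comp; last exact: continuous_expR.
apply: continuousN; apply: continuousM; first exact: cvg_cst.
by apply: continuous_min; [exact: cvg_id|exact: cvg_cst].
Qed.

Lemma integral_slope_small u : 0 <= u -> u <= a ->
  \int[lebesgue_measure]_(s in `[0, u]) slope q a s = profile q a u.
Proof.
rewrite le_eqVlt => /predU1P[<- _|u0 ua].
  by rewrite set_itv1 Rintegral_set1 profile0.
pose F (s : R^o) : R^o := - q^-1 * expR (- q * s).
have dF (s : R) : is_derive s (1:R) F (expR (- q * s)).
  have d1 : is_derive s (1:R) (- q \*: (id : R^o -> R^o)) (- q *: (1:R^o)).
    by apply: is_deriveZ; exact: is_derive_id.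
  have d2 : is_derive s (1:R) (expR \o (- q \*: (id : R^o -> R^o)))
      (expR (- q * s) * (- q *: (1:R^o))).
    by apply: is_derive1_comp; exact: is_derive_expR.
  have := is_deriveZ (- q^-1) d2; rewrite (_ : _ \*: _ = F)//.
  congr is_derive; rewrite -[LHS]/(- q^-1 * (expR (- q * s) * (- q * 1))).
  by rewrite mulr1 mulrCA mulrNN mulVf// mulr1.
rewrite /Rintegral (@continuous_FTC2 _ (slope q a) F 0 u)//.
- rewrite -EFinB /= /F profile_small//.
  by rewrite mulr0 expR0 -(mulNr q u); field.
- exact/continuous_subspaceT/continuous_slope.
- have cF : continuous F.
    by move=> s; apply/differentiable_continuous/derivable1_diffP; case: (dF s).
  split.
  + by move=> s _; case: (dF s).
  + exact/cvg_at_right_filter/cF.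
  + exact/cvg_at_left_filter/cF.
- move=> s; rewrite in_itv/= => /andP[_ su].
  rewrite derive1E (@derive_val _ _ _ _ _ _ _ (dF s)) /slope min_l ?mulNr//.
  by rewrite ltW// (lt_le_trans su).
Qed.

Lemma integral_slope r : 0 <= r ->
  \int[lebesgue_measure]_(s in `[0, r]) slope q a s = profile q a r.
Proof.
move=> r0; have [ra|ar] := leP r a; first exact: integral_slope_small.
have iS : lebesgue_measure.-integrable `[0, r] (EFin \o slope q a).
  apply: continuous_compact_integrable; first exact: segment_compact.
  exact/continuous_subspaceT/continuous_slope.
have := @Rintegral_itvB _ (slope q a) (BLeft 0) (BRight r) a iS.
rewrite !bnd_simp (ltW ar) => /(_ a0 isT) /eqP.
rewrite subr_eq => /eqP ->.
rewrite integral_slope_small// (profile_large q (ltW ar)) addrC; congr (_ + _).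
under eq_Rintegral.
  move=> s; rewrite inE/= in_itv/= => /andP[/ltW as_ _].
  rewrite (_ : slope q a s = slope q a a); last by rewrite /slope minxx min_r.
  over.
rewrite Rintegral_cst//= lebesgue_measure_itv/= lte_fin ar -EFinB/=.
by rewrite mulrC.
Qed.

End profile_integral.

(** * Affine substitution and the standard normal law *)
Section lebesgue_substitution.
Variable R : realType.
Local Notation mu := (@lebesgue_measure R).
Local Open Scope ereal_scope.

(** Stated for an arbitrary nonnegative measurable integrand: laws of Gaussian
    vectors are identified on indicators, where a substitution rule for
    continuous integrands does not apply.  The image of the Lebesgue measure
    under an increasing affine map is computed on intervals. *)
Lemma ge0_integral_affine (c b : R) (g : R -> \bar R) : (0 < b)%R ->
  measurable_fun [set: R] g -> (forall x, 0 <= g x) ->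
  b%:E * \int[mu]_y g (c + b * y)%R = \int[mu]_y g y.
Proof.
move=> b0 mg g0.
pose T (y : measurableTypeR R) : measurableTypeR R := (c + b * y)%R.
have mT : measurable_fun setT T.
  by apply: measurable_funD => //; exact: measurable_funM.
pose b' : {nonneg R} := NngNum (ltW b0).
pose m0 := (pushforward mu T : {measure set (measurableTypeR R) -> \bar R}).
pose m' : {measure set (measurableTypeR R) -> \bar R} := mscale b' (m0 mT).
have E A : measurable A -> mu A = m' A.
  apply: lebesgue_measure_unique => _ [[a1 a2]] _ <-.
  rewrite -[RHS]/(b%:E * mu (T @^-1` `]a1, a2]%classic)).
  rewrite (_ : T @^-1` _ = `]((a1 - c) / b)%R, ((a2 - c) / b)%R]%classic); last first.
    by apply/seteqP; split => y /=; rewrite /T !in_itv/= ltr_pdivrMr// ler_pdivlMr//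
      (mulrC y) ltrBlDl lerBrDl.
  rewrite !lebesgue_measure_itv/= !lte_fin ltr_pM2r ?invr_gt0// ltrD2r.
  case: ifPn => _; last by rewrite mule0.
  by rewrite -EFinB -EFinM; congr EFin; field; rewrite gt_eqF.
rewrite [RHS](eq_measure_integral m'); last by move=> A mA _; exact: E.
rewrite /m' ge0_integral_mscale//=; congr (_ * _); apply/esym.
by rewrite [LHS](ge0_integral_pushforward mT)// => x _; exact: g0.
Qed.

Lemma ge0_integral_opp (g : R -> \bar R) :
  measurable_fun [set: R] g -> (forall x, 0 <= g x) ->
  \int[mu]_y g (- y)%R = \int[mu]_y g y.
Proof.
move=> mg g0.
transitivity (\int[pushforward mu (-%R : _ -> measurableTypeR R)]_y g y).
  by rewrite ge0_integral_pushforward.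
by apply: eq_measure_integral => //= A mA _; exact: lebesgue_measureN.
Qed.

End lebesgue_substitution.

Section standard_gaussian.
Variable R : realType.
Local Notation mu := (@lebesgue_measure R).
Local Notation phi := (@normal_pdf R 0 1).
Local Notation gauss := (@normal_prob R 0 1).

Lemma normal_pdf01E (x : R) : phi x = normal_peak 1 * expR (- x ^+ 2 / 2).
Proof.
by rewrite normal_pdfE ?oner_eq0// /normal_fun subr0 expr1n.
Qed.

Lemma normal_pdf01_gt0 (x : R) : 0 < phi x.
Proof. by rewrite normal_pdf01E mulr_gt0 ?expR_gt0// normal_peak_gt0 ?oner_eq0. Qed.

Lemma normal_pdf01N (x : R) : phi (- x) = phi x.
Proof. by rewrite !normal_pdf01E sqrrN. Qed.

Lemma normal_pdf01_shift (s x : R) : phi (x + s) = expR (- (s * x) - s ^+ 2 / 2) * phi x.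
Proof.
rewrite !normal_pdf01E mulrCA -expRD; congr (_ * expR _).
by field.
Qed.

Lemma normal_pdf01M (x y z w : R) : x ^+ 2 + y ^+ 2 = z ^+ 2 + w ^+ 2 ->
  phi x * phi y = phi z * phi w.
Proof.
move=> e; rewrite !normal_pdf01E mulrACA [RHS]mulrACA -!expRD.
congr (_ * expR _).
have E a b : - a ^+ 2 / 2 + - b ^+ 2 / 2 = - (a ^+ 2 + b ^+ 2) / 2 :> R by field.
by rewrite !E e.
Qed.

(** Invariance of the planar density under a rotation, written in the
    coordinates [x] and [z = al * x + be * y] instead of [x] and [y]. *)
Lemma normal_pdf01_rotation (al be x z : R) : be != 0 -> al ^+ 2 + be ^+ 2 = 1 ->
  phi x * phi ((z - al * x) / be) = phi z * phi ((x - al * z) / be).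
Proof.
move=> b0 ab; apply: normal_pdf01M.
have e : be ^+ 2 = 1 - al ^+ 2 by rewrite -ab addrAC subrr add0r.
apply: (mulIf (expf_neq0 2 b0)).
have H u : (u / be) ^+ 2 * be ^+ 2 = u ^+ 2 by rewrite -exprMn divfK.
by rewrite [LHS]mulrDl [RHS]mulrDl !H e; ring.
Qed.

Local Open Scope ereal_scope.

Lemma measurable_normal_pdf01 : measurable_fun [set: R] (fun x => (phi x)%:E).
Proof. by apply/measurable_EFinP; exact: measurable_normal_pdf. Qed.

(** The density of a measure is determined almost everywhere, so the
    Radon-Nikodym derivative of the normal law is its probability density. *)
Lemma ge0_integral_normal (g : R -> \bar R) :
  measurable_fun [set: R] g -> (forall x, 0 <= g x) ->
  \int[gauss]_x g x = \int[mu]_x (g x * (phi x)%:E).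
Proof.
move=> mg g0; have dom := @normal_prob_dominates R 0 1.
pose f := Radon_Nikodym_SigmaFinite.f gauss mu.
have mf : measurable_fun setT f.
  exact: measurable_int (Radon_Nikodym_SigmaFinite.f_integrable dom).
have mphi := measurable_normal_pdf01.
have ae : ae_eq mu setT f (fun x => (phi x)%:E).
  apply: integral_ae_eq => //.
  - exact: (Radon_Nikodym_SigmaFinite.f_integrable dom).
  - by move=> A _ mA; rewrite -Radon_Nikodym_SigmaFinite.f_integral.
rewrite -(Radon_Nikodym_SigmaFinite.change_of_variables dom)//.
apply: ge0_ae_eq_integral => //.
- exact: emeasurable_funM.
- exact: emeasurable_funM.
- move=> x _; rewrite mule_ge0//; exact: Radon_Nikodym_SigmaFinite.f_ge0.
- by move=> x _; rewrite mule_ge0// lee_fin ltW// normal_pdf01_gt0.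
- by apply: filterS ae => x h Dx; congr (_ * _); exact: h.
Qed.

Lemma ge0_integral_normal_opp (g : R -> \bar R) :
  measurable_fun [set: R] g -> (forall x, 0 <= g x) ->
  \int[gauss]_x g (- x)%R = \int[gauss]_x g x.
Proof.
move=> mg g0; rewrite !ge0_integral_normal//; last first.
  by apply: measurableT_comp => //; exact: measurable_oppr.
rewrite -[RHS]ge0_integral_opp.
- by under [RHS]eq_integral do rewrite normal_pdf01N.
- by apply: emeasurable_funM => //; exact: measurable_normal_pdf01.
- by move=> x; rewrite mule_ge0// lee_fin ltW// normal_pdf01_gt0.
Qed.

(** The Cameron-Martin formula in dimension one. *)
Lemma ge0_integral_normal_shift (s : R) (g : R -> \bar R) :
  measurable_fun [set: R] g -> (forall x, 0 <= g x) ->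
  \int[gauss]_x (g x * (expR (- (s * x) - s ^+ 2 / 2))%:E) =
  \int[gauss]_x g (x - s)%R.
Proof.
move=> mg g0.
have mgs : measurable_fun [set: R] (fun x : R => g (x - s)%R).
  by apply: measurableT_comp => //; exact: measurable_funB.
have mE : measurable_fun [set: R] (fun x : R => (expR (- (s * x) - s ^+ 2 / 2))%:E).
  apply/measurable_EFinP/measurableT_comp => //; apply: measurable_funB => //.
  by apply: measurableT_comp => //; exact: measurable_funM.
have p0 x : 0 <= (phi x)%:E by rewrite lee_fin ltW// normal_pdf01_gt0.
rewrite !ge0_integral_normal//; last 2 first.
- exact: emeasurable_funM.
- by move=> x; rewrite mule_ge0// lee_fin expR_ge0.
rewrite -[RHS](@ge0_integral_affine _ s 1)//; last 2 first.
- by apply: emeasurable_funM => //; exact: measurable_normal_pdf01.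
- by move=> x; rewrite mule_ge0.
rewrite mul1e; apply: eq_integral => x _; rewrite mul1r.
by rewrite (addrC s) addrK normal_pdf01_shift EFinM muleA.
Qed.

End standard_gaussian.

(** * Linear combinations of independent normal variables *)
Section gaussian_convolution.
Variable R : realType.
Local Notation mu := (@lebesgue_measure R).
Local Notation phi := (@normal_pdf R 0 1).
Local Notation gauss := (@normal_prob R 0 1).
Local Open Scope ereal_scope.

(** For fixed [x], substitute [z = al * x + be * y] for [y]; after exchanging the
    integrals, the rotation identity for the densities leaves a normal density
    in [x], whose integral is 1. *)
Lemma ge0_integral_normal_rotation (al be : R) (g : R -> \bar R) :
  (0 < be)%R -> (al ^+ 2 + be ^+ 2 = 1)%R ->
  measurable_fun [set: R] g -> (forall x, 0 <= g x) ->
  \int[gauss]_x \int[gauss]_y g (al * x + be * y)%R = \int[gauss]_z g z.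
Proof.
move=> be0 albe mg g0.
have ben0 : be != 0%R by rewrite gt_eqF.
have ibe0 : (0 < be^-1)%R by rewrite invr_gt0.
have p0 x : 0 <= (phi x)%:E by rewrite lee_fin ltW// normal_pdf01_gt0.
have mphi := @measurable_normal_pdf01 R.
have mx : measurable_fun [set: R * R] (@fst R R) by exact: measurable_fst.
have my : measurable_fun [set: R * R] (@snd R R) by exact: measurable_snd.
have mlin : measurable_fun [set: R * R] (fun w : R * R => al * w.1 + be * w.2)%R.
  by apply: measurable_funD; apply: measurable_funM.
have mG : measurable_fun [set: R * R] (fun w : R * R => g (al * w.1 + be * w.2)%R).
  by apply: measurableT_comp.
have mlin1 x : measurable_fun [set: R] (fun y => al * x + be * y)%R.
  by apply: measurable_funD => //; exact: measurable_funM.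
have mratio : measurable_fun [set: R * R] (fun w : R * R => (w.2 - al * w.1) / be)%R.
  apply: measurable_funM => //; apply: measurable_funB => //.
  exact: measurable_funM.
pose K (w : R * R) : \bar R :=
  be^-1%:E * (g w.2 * ((phi w.1)%:E * (phi ((w.2 - al * w.1) / be)%R)%:E)).
have K0 w : 0 <= K w by rewrite mule_ge0 ?lee_fin ?(ltW ibe0)// !mule_ge0.
have mK : measurable_fun setT K.
  apply: emeasurable_funM => //; apply: emeasurable_funM.
    exact: (measurableT_comp mg my).
  apply: emeasurable_funM; first exact: (measurableT_comp mphi mx).
  exact: (measurableT_comp mphi mratio).
have mF : measurable_fun [set: R] (fun x => \int[gauss]_y g (al * x + be * y)%R).
  apply: (measurable_fun_fubini_tonelli_F (m2 := gauss)
    (fun w : R * R => g (al * w.1 + be * w.2)%R)) => //.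
rewrite ge0_integral_normal//; last by move=> x; exact: integral_ge0.
transitivity (\int[mu]_x \int[mu]_z K (x, z)).
  apply: eq_integral => x _.
  have mg1 : measurable_fun [set: R] (fun y : R => g (al * x + be * y)%R).
    exact: measurableT_comp.
  rewrite ge0_integral_normal//.
  rewrite -(@ge0_integral_affine _ (- (al * x / be)) be^-1)//; last 2 first.
  - exact: emeasurable_funM.
  - by move=> y; rewrite mule_ge0.
  have e z : (al * x + be * (- (al * x / be) + be^-1 * z) = z)%R by field.
  have e' z : (- (al * x / be) + be^-1 * z = (z - al * x) / be)%R by field.
  under eq_integral do rewrite e e'.
  have mL : measurable_fun [set: R] (fun z : R => g z * (phi ((z - al * x) / be)%R)%:E).
    apply: emeasurable_funM => //; apply: (measurableT_comp mphi).
    by apply: measurable_funM => //; exact: measurable_funB.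
  rewrite muleAC -ge0_integralZl//; last 2 first.
  - by move=> z _; rewrite mule_ge0.
  - by rewrite mule_ge0// lee_fin ltW.
  apply: eq_integral => z _; rewrite /K/= -!muleA; congr (_ * _).
  by rewrite muleCA.
rewrite fubini_tonelli// ge0_integral_normal//.
apply: eq_integral => z _.
have mq : measurable_fun [set: R] (fun x : R => (phi ((x - al * z) / be)%R)%:E).
  apply: (measurableT_comp mphi); apply: measurable_funM => //.
  exact: measurable_funB.
transitivity (\int[mu]_x (g z * (phi z)%:E * be^-1%:E * (phi ((x - al * z) / be)%R)%:E)).
  apply: eq_integral => x _; rewrite /K/= -EFinM normal_pdf01_rotation// EFinM.
  by rewrite muleC -!muleA; congr (_ * (_ * _)); rewrite muleC.
rewrite ge0_integralZl//; last by rewrite !mule_ge0// lee_fin ltW.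
rewrite -[RHS]mule1 -!muleA; congr (_ * (_ * _)).
rewrite -(integral_normal_pdf (0 : R)%R 1%R).
rewrite -[RHS](ge0_integral_affine (- (al * z / be)) ibe0 mphi p0).
have e x : (- (al * z / be) + be^-1 * x = (x - al * z) / be)%R by field.
by congr (_ * _); apply: eq_integral => x _; rewrite e.
Qed.

Lemma ge0_integral_normal_conv (a e : R) (g : R -> \bar R) : (0 <= a)%R ->
  measurable_fun [set: R] g -> (forall x, 0 <= g x) ->
  \int[gauss]_x \int[gauss]_y g (a * x + e * y)%R =
  \int[gauss]_z g (Num.sqrt (a ^+ 2 + e ^+ 2) * z)%R.
Proof.
move=> a0 mg g0.
have mga b c : measurable_fun [set: R] (fun y : R => g (b + c * y)%R).
  by apply: (measurableT_comp mg); apply: measurable_funD => //.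
have [->|e0] := eqVneq e 0%R.
  rewrite expr0n addr0 sqrtr_sqr ger0_norm//; apply: eq_integral => x _.
  under eq_integral do rewrite mul0r addr0.
  by rewrite integral_cst// [X in _ * X]probability_setT mule1.
(* the law of the second coordinate is symmetric, so its sign can be absorbed *)
transitivity (\int[gauss]_x \int[gauss]_y g (a * x + `|e| * y)%R).
  apply: eq_integral => x _; case: (ger0P e) => // _.
  rewrite -ge0_integral_normal_opp//.
  by apply: eq_integral => y _; rewrite mulrN mulNr.
set c := Num.sqrt _.
have c2 : (c ^+ 2 = a ^+ 2 + e ^+ 2)%R by rewrite sqr_sqrtr// addr_ge0// sqr_ge0.
have c0 : (0 < c)%R.
  by rewrite sqrtr_gt0 ltr_pwDr ?sqr_ge0// exprn_even_gt0.
have cn0 : c != 0%R by rewrite gt_eqF.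
have bec : (0 < `|e| / c)%R by rewrite divr_gt0// normr_gt0.
have unit : ((a / c) ^+ 2 + (`|e| / c) ^+ 2 = 1)%R.
  by rewrite !expr_div_n -mulrDl real_normK ?num_real// -c2 divff// expf_neq0.
have mgc : measurable_fun [set: R] (fun y : R => g (c * y)%R).
  by apply: (measurableT_comp mg).
have gc0 x : 0 <= g (c * x)%R by exact: g0.
rewrite -(ge0_integral_normal_rotation bec unit mgc gc0).
apply: eq_integral => x _; apply: eq_integral => y _; congr (g _); field.
exact: cn0.
Qed.

End gaussian_convolution.

(** * The law of a scalar product with a standard Gaussian vector *)
Section rectangles.
Context d1 d2 (T1 : measurableType d1) (T2 : measurableType d2) (R : realType).
Local Open Scope ereal_scope.

Lemma measure_rectangle_unique (m1 m2 : {measure set (T1 * T2) -> \bar R}) :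
  m1 setT < +oo ->
  (forall A B, measurable A -> measurable B -> m1 (A `*` B) = m2 (A `*` B)) ->
  forall X, measurable X -> m1 X = m2 X.
Proof.
move=> m1oo m12 X mX.
pose G : set (set (T1 * T2)) :=
  [set A `*` B | A in measurable & B in measurable].
apply: (measure_unique G (fun=> setT)) => //.
- by rewrite measurable_prod_measurableType.
- move=> _ _ [A mA [B mB <-]] [A' mA' [B' mB' <-]].
  rewrite -setXI; exists (A `&` A'); first exact: measurableI.
  by exists (B `&` B') => //; exact: measurableI.
- by move=> _; exists setT => //; exists setT => //; rewrite setXTT.
- by rewrite bigcup_const.
- by move=> _ [A mA [B mB <-]]; exact: m12.
Qed.

End rectangles.

Section linear_image.
Context disp (T : measurableType disp) (R : realType) (P : probability T R).
Variables (d : nat) (Z : {RV P >-> d.-tuple R}) (e : 'I_d -> R).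
Hypothesis gaussZ : std_gaussian_vector Z.
Local Notation gauss := (@normal_prob R 0 1).

(** The scalar product is built up one coordinate at a time. *)
Definition partial_dot k (t : T) : R := \sum_(i < d | (i < k)%N) e i * tnth (Z t) i.
Definition partial_norm k : R := Num.sqrt (\sum_(i < d | (i < k)%N) e i ^+ 2).

Lemma measurable_coord i : measurable_fun [set: T] (fun t => tnth (Z t) i).
Proof.
apply: (measurableT_comp (measurable_tnth i)); exact: measurable_funPT.
Qed.

Lemma measurable_partial_dot k : measurable_fun [set: T] (partial_dot k).
Proof.
rewrite (_ : partial_dot k = fun t => \sum_(i < d)
  (if (i < k)%N then e i * tnth (Z t) i else 0)); last first.
  by apply/funext => t; rewrite /partial_dot big_mkcond.
apply: measurable_sum => i; case: (i < k)%N => //.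
by apply: measurable_funM => //; exact: measurable_coord.
Qed.

Lemma measurable_tail_box k (B : 'I_d -> set R) : (forall i, measurable (B i)) ->
  measurable [set t | forall i : 'I_d, (k <= i)%N -> B i (tnth (Z t) i)].
Proof.
move=> mB.
rewrite (_ : [set t | _] =
  \bigcap_(i in [set i : 'I_d | (k <= i)%N]) ((fun t => tnth (Z t) i) @^-1` B i)).
  apply: fin_bigcap_measurable => [|i _]; first exact: finite_finset.
  by rewrite -[X in measurable X]setTI; exact: measurable_coord.
by apply/seteqP; split => t /= h i; exact: h.
Qed.

Lemma partial_dotS k (kd : (k < d)%N) t :
  partial_dot k.+1 t = partial_dot k t + e (Ordinal kd) * tnth (Z t) (Ordinal kd).
Proof.
rewrite /partial_dot (bigD1 (Ordinal kd))//= addrC; congr (_ + _).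
apply: eq_bigl => i; rewrite ltnS ltn_neqAle andbC; congr (_ && _).
Qed.

Lemma partial_normS k (kd : (k < d)%N) :
  partial_norm k.+1 = Num.sqrt (partial_norm k ^+ 2 + e (Ordinal kd) ^+ 2).
Proof.
rewrite /partial_norm sqr_sqrtr; last by apply: sumr_ge0 => i _; exact: sqr_ge0.
congr Num.sqrt; rewrite (bigD1 (Ordinal kd))//= addrC; congr (_ + _).
apply: eq_bigl => i; rewrite ltnS ltn_neqAle andbC; congr (_ && _).
Qed.

Local Open Scope ereal_scope.

(** The law of a Gaussian vector is only known on boxes, hence the form of the
    invariant: the first [k] coordinates enter through their weighted sum, the
    others still through a box, and the two groups are independent.  For the
    step, the pair formed by the sum and the coordinate [k], restricted to the
    event that the later coordinates lie in their box, has a multiple of a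
    product law; absorbing the coordinate into the sum is a convolution.
    Writing the law of the sum as that of [partial_norm k] times a standard
    normal variable avoids degenerate normal laws. *)
Lemma partial_dot_law k : (k <= d)%N ->
  forall (A : set R) (B : 'I_d -> set R), measurable A -> (forall i, measurable (B i)) ->
  P ([set t | A (partial_dot k t)] `&`
     [set t | forall i : 'I_d, (k <= i)%N -> B i (tnth (Z t) i)]) =
  gauss [set w | A (partial_norm k * w)%R] * \prod_(i < d | (k <= i)%N) gauss (B i).
Proof.
elim: k => [_ A B mA mB|k IH kd A B mA mB].
  have := gaussZ mB; rewrite /distribution/= /pushforward.
  have -> : partial_norm 0 = 0%R by rewrite /partial_norm big_pred0_eq sqrtr0.
  have e0 t : partial_dot 0 t = 0%R by rewrite /partial_dot big_pred0_eq.
  rewrite (_ : [set t | A (partial_dot 0 t)] = [set _ | A 0%R]); last first.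
    by apply/seteqP; split => t /=; rewrite e0.
  rewrite (_ : [set w | A (0 * w)%R] = [set _ | A 0%R]); last first.
    by apply/seteqP; split => w /=; rewrite mul0r.
  have [A0|nA0] := pselect (A 0%R).
    have AT (X : Type) : [set _ : X | A 0%R] = setT by apply/seteqP; split.
    rewrite !AT => <-; rewrite setTI [X in X * _]probability_setT mul1e.
    by congr (P _); apply/seteqP; split => [t h i|t h i _]; exact: h.
  have AF (X : Type) : [set _ : X | A 0%R] = set0 by apply/seteqP; split.
  by rewrite !AF set0I !measure0 mul0e.
pose i0 := Ordinal kd.
pose D := [set t | forall i : 'I_d, (k < i)%N -> B i (tnth (Z t) i)].
have mD : measurable D by exact: measurable_tail_box.
pose F (t : T) : R * R := (partial_dot k t, tnth (Z t) i0).
have mF : measurable_fun [set: T] F.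
  apply/measurable_fun_pairP; split; first exact: measurable_partial_dot.
  exact: measurable_coord.
pose G (w : R * R) : R * R := ((partial_norm k * w.1)%R, w.2).
have mG : measurable_fun [set: R * R] G.
  by apply/measurable_fun_pairP; split; [exact: measurable_funM|exact: measurable_snd].
pose c := \prod_(i < d | (k < i)%N) gauss (B i).
have cfin : c \is a fin_num.
  by apply: prode_fin_num => i _; apply: fin_num_measure; exact: mB.
have c0 : (0 <= fine c)%R.
  by apply: fine_ge0; apply: prode_ge0 => i _; exact: measure_ge0.
pose m1 := (pushforward (mrestr P mD) F : {measure set (R * R) -> \bar R}).
pose m2' := (pushforward (gauss \x gauss) G : {measure set (R * R) -> \bar R}).
pose m2 : {measure set (R * R) -> \bar R} := mscale (NngNum c0) (m2' mG).
have Pfin (X : set T) : measurable X -> P X < +oo.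
  by move=> mX; rewrite ltey_eq fin_num_measure.
have gauss_scale (s : R) (X : set R) : measurable X ->
    measurable [set w | X (s * w)%R].
  by move=> mX; rewrite -[X in measurable X]setTI; exact: measurable_funM.
have m12 : forall X, measurable X -> m1 mF X = m2 X.
  apply: measure_rectangle_unique.
    by apply: Pfin; rewrite setTI.
  move=> A1 A2 mA1 mA2.
  pose B' i := if i == i0 then A2 else B i.
  have mB' i : measurable (B' i) by rewrite /B'; case: ifP.
  rewrite -[LHS]/(P (F @^-1` (A1 `*` A2) `&` D)).
  rewrite -[RHS]/((fine c)%:E * (gauss \x gauss) (G @^-1` (A1 `*` A2))).
  rewrite (_ : F @^-1` _ `&` D = [set t | A1 (partial_dot k t)] `&`
     [set t | forall i : 'I_d, (k <= i)%N -> B' i (tnth (Z t) i)]); last first.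
    apply/seteqP; split => [t [[/= h1 h2] h3]|t [/= h1 h2]].
      split => // i ki; rewrite /B'; case: eqP => [->//|/eqP ii0].
      by apply: h3; rewrite ltn_neqAle ki andbT eq_sym.
    split; first by split => //=; have := h2 i0 (leqnn _); rewrite /B' eqxx.
    move=> i ki; have := h2 i (ltnW ki); rewrite /B'; case: eqP => // ii0.
    by move: ki; rewrite ii0 ltnn.
  rewrite IH//; last exact: ltnW.
  rewrite (_ : G @^-1` _ = [set w | A1 (partial_norm k * w)%R] `*` A2)//.
  rewrite product_measure1E//; last exact: gauss_scale.
  rewrite fineK// [RHS]muleCA; congr (_ * _).
  rewrite (bigD1 i0)//= /B' eqxx [RHS]muleC; congr (_ * _).
  apply: eq_big => [i|i /andP[_ /negbTE ->]//].
  by rewrite ltn_neqAle andbC eq_sym.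
have mS : measurable [set w : R * R | A (w.1 + e i0 * w.2)%R].
  rewrite -[X in measurable X]setTI.
  apply: (_ : measurable_fun [set: R * R] (fun w => w.1 + e i0 * w.2)%R) => //.
  by apply: measurable_funD => //; exact: measurable_funM.
have := m12 _ mS.
rewrite -[LHS in LHS = _ -> _]/(P (F @^-1` [set w : R * R | A (w.1 + e i0 * w.2)%R] `&` D)).
rewrite (_ : F @^-1` _ = [set t | A (partial_dot k.+1 t)]); last first.
  by apply/seteqP; split => t; rewrite /= partial_dotS.
move=> ->.
pose S := [set w : R * R | A (partial_norm k * w.1 + e i0 * w.2)%R].
rewrite -[LHS]/((fine c)%:E * (gauss \x gauss) S) fineK// muleC; congr (_ * _).
have mS' : measurable S.
  rewrite -[X in measurable X]setTI.
  exact: (mG measurableT _ mS).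
have mA' : measurable_fun [set: R] (fun x : R => (\1_A x)%:E : \bar R).
  by apply/measurable_EFinP; apply: measurable_indic.
have A0 x : 0 <= (\1_A x)%:E :> \bar R by rewrite lee_fin.
transitivity (\int[gauss \x gauss]_w (\1_S w)%:E).
  have := integral_indic (gauss \x gauss) measurableT mS'.
  by rewrite setIT => ->.
have mS'' : measurable_fun [set: R * R] (fun w : R * R => (\1_S w)%:E : \bar R).
  by apply/measurable_EFinP; apply: measurable_indic.
rewrite fubini_tonelli1//.
transitivity (\int[gauss]_x \int[gauss]_y
    (\1_A (partial_norm k * x + e i0 * y)%R)%:E : \bar R).
  by apply: eq_integral => x _; apply: eq_integral => y _; congr EFin.
have a0 : (0 <= partial_norm k)%R by exact: sqrtr_ge0.
rewrite (ge0_integral_normal_conv (e i0) a0 mA' A0).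
rewrite -partial_normS.
transitivity (\int[gauss]_z (\1_[set w | A (partial_norm k.+1 * w)%R] z)%:E).
  by apply: eq_integral => x _; congr EFin.
have := integral_indic gauss measurableT (gauss_scale (partial_norm k.+1) _ mA).
by rewrite setIT => ->.
Qed.

Lemma dot_law (A : set R) : measurable A -> (\sum_(i < d) e i ^+ 2 = 1)%R ->
  P [set t | A (\sum_(i < d) e i * tnth (Z t) i)%R] = gauss A.
Proof.
move=> mA e1; have := partial_dot_law (leqnn d) mA (fun _ => measurableT).
rewrite [X in _ * X]big_pred0 ?mule1; last by move=> i; rewrite leqNgt ltn_ord.
have -> : partial_norm d = 1%R.
  rewrite /partial_norm (eq_bigl xpredT) ?e1 ?sqrtr1// => i.
  by rewrite ltn_ord.
rewrite (_ : [set w | A (1 * w)%R] = A); last first.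
  by apply/seteqP; split => w /=; rewrite mul1r.
have pd t : partial_dot d t = (\sum_(i < d) e i * tnth (Z t) i)%R.
  by rewrite /partial_dot; apply: eq_bigl => i; rewrite ltn_ord.
move=> <-; congr (P _); apply/seteqP; split => [t At|t [/= At _]].
  by split=> //=; rewrite pd.
by rewrite -pd.
Qed.

End linear_image.

(** * Expectations under the acceptance-rejection step *)
Section rejection.
Variable R : realType.
Local Notation gauss := (@normal_prob R 0 1).
Local Notation RR := (measurableTypeR R * measurableTypeR R)%type.
Local Notation unif := (uniform_prob (@ltr01 R)).
Local Open Scope ereal_scope.

Lemma uniform01_gt (p : R) : (0 <= p)%R ->
  unif [set u | ~~ (u <= p)%R] = (Num.max 0 (1 - p)%R)%:E.
Proof.
move=> p0; rewrite /uniform_prob integral_uniform_pdf.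
rewrite (_ : _ `&` _ = `]p, 1%R]%classic); last first.
  apply/seteqP; split => u; rewrite /= !in_itv/= -ltNge.
    by move=> [-> /andP[_ ->]].
  by move=> /andP[pu ->]; rewrite pu andbT (le_trans p0 (ltW pu)).
rewrite (eq_integral (cst 1%:E)); last first.
  move=> u; rewrite inE/= in_itv/= => /andP[pu u1].
  by rewrite /uniform_pdf u1 (le_trans p0 (ltW pu)) subr0 invr1.
rewrite integral_cst//= mul1e lebesgue_measure_itv/= lte_fin.
case: ltP => p1; first by rewrite -EFinB max_r// subr_ge0 ltW.
by rewrite max_l// subr_le0.
Qed.

Context disp (T : measurableType disp) (P : probability T R) (d : nat).
Variables (Z : {RV P >-> d.-tuple R}) (U : {RV P >-> R}) (e : 'I_d -> R).
Hypotheses (gaussZ : std_gaussian_vector Z) (unifU : uniform01 U).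
Hypothesis indep : independent_RV Z U.
Hypothesis e1 : (\sum_(i < d) e i ^+ 2 = 1)%R.

Definition linear_image (t : T) : R := (\sum_(i < d) e i * tnth (Z t) i)%R.
Local Notation W := linear_image.

Lemma measurable_linear_image : measurable_fun [set: T] W.
Proof.
apply: measurable_sum => i; apply: measurable_funM => //.
exact: measurable_coord.
Qed.

Lemma measurable_uniform : measurable_fun [set: T] U.
Proof. exact: measurable_funPT. Qed.

Lemma joint_law (X : set RR) : measurable X ->
  P ((fun t => (W t, U t)) @^-1` X) = (gauss \x unif) X.
Proof.
pose F t : RR := (W t, U t).
have mF : measurable_fun [set: T] F.
  apply/measurable_fun_pairP; split; first exact: measurable_linear_image.
  exact: measurable_uniform.
pose m1 := (pushforward P F : {measure set RR -> \bar R}).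
move=> mX; apply/esym.
apply: (@product_measure_unique _ _ _ _ _ gauss unif (m1 mF)) => //.
move=> A B mA mB.
pose S : set (d.-tuple R) := [set z | A (\sum_(i < d) e i * tnth z i)%R].
have mS : measurable S.
  rewrite -[X in measurable X]setTI.
  apply: (_ : measurable_fun [set: d.-tuple R] (fun z => \sum_(i < d) e i * tnth z i)%R) => //.
  apply: measurable_sum => i; apply: measurable_funM => //.
  exact: measurable_tnth.
rewrite -[LHS]/(P (Z @^-1` S `&` U @^-1` B)) indep//.
congr (_ * _); first exact: dot_law.
exact: unifU.
Qed.

(** Integrating out the uniform variable replaces the rejection event by its
    conditional probability given the Gaussian vector. *)
Lemma integral_rejection (p G : R -> R) :
  measurable_fun [set: R] p -> (forall w, 0 <= p w)%R ->
  measurable_fun [set: R] G -> (forall w, 0 <= G w)%R ->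
  \int[P]_t (if (U t <= p (W t))%R then 0%R else G (W t))%:E =
  \int[gauss]_w (G w * Num.max 0 (1 - p w))%:E.
Proof.
move=> mp p0 mG G0.
pose V : set RR := [set w | ~~ (w.2 <= p w.1)%R].
have mV : measurable V.
  rewrite /V -[X in measurable X]setTI.
  apply: measurable_neg => //.
  by apply: measurable_fun_ler => //; exact: measurableT_comp.
pose H (w : RR) : \bar R := (G w.1)%:E * (\1_V w)%:E.
have H0 w : 0 <= H w by rewrite mule_ge0// lee_fin.
have mH : measurable_fun [set: RR] H.
  apply: emeasurable_funM; apply/measurable_EFinP; first exact: measurableT_comp.
  by apply: measurable_indic.
pose F t : RR := (W t, U t).
have mF : measurable_fun [set: T] F.
  apply/measurable_fun_pairP; split; first exact: measurable_linear_image.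
  exact: measurable_uniform.
transitivity (\int[P]_t (H (F t))).
  apply: eq_integral => t _; rewrite /H indicE /F /=.
  case: (boolP (U t <= p (W t))%R) => h.
    by rewrite memNset ?mule0// /V/= h.
  by rewrite mem_set ?mule1.
transitivity (\int[pushforward P F]_w H w).
  by rewrite (ge0_integral_pushforward mF).
rewrite (eq_measure_integral (gauss \x unif)); last first.
  by move=> X mX _; exact: joint_law.
rewrite fubini_tonelli1//; apply: eq_integral => w _.
have mVw : measurable [set u : measurableTypeR R | ~~ (u <= p w)%R].
  have := measurable_xsection w mV; congr measurable.
  by apply/seteqP; split => u; rewrite /xsection/= inE.
transitivity (\int[unif]_u
    ((G w)%:E * (\1_[set u : measurableTypeR R | ~~ (u <= p w)%R] u)%:E)).
  by apply: eq_integral => u _; congr (_ * _%:E).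
rewrite ge0_integralZl//; last 2 first.
- by apply/measurable_EFinP; apply: measurable_indic.
- by rewrite lee_fin.
rewrite EFinM; congr (_ * _); rewrite -uniform01_gt//.
have := integral_indic unif measurableT mVw.
by rewrite setIT => <-.
Qed.

End rejection.

(** * The coupled distance is preserved in mean *)
Section reflected_gaussian.
Variable R : realType.
Local Notation gauss := (@normal_prob R 0 1).
Local Open Scope ereal_scope.

Let pos_part (a b w : R) : \bar R := (Num.max 0 (a + b * w)%R)%:E.

Let pos_part_ge0 a b w : 0 <= pos_part a b w.
Proof. by rewrite lee_fin le_max lexx. Qed.

Let measurable_pos_part a b : measurable_fun [set: R] (pos_part a b).
Proof.
apply/measurable_EFinP; apply: measurable_maxr => //.
by apply: measurable_funD => //; exact: measurable_funM.
Qed.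

Let pos_part_sym a b :
  \int[gauss]_w pos_part a b w = \int[gauss]_w pos_part a (- b)%R w.
Proof.
rewrite -ge0_integral_normal_opp//.
by apply: eq_integral => w _; rewrite /pos_part mulrN mulNr.
Qed.

(** The Gaussian exponential moment dominates the first absolute moment. *)
Let pos_part_fin : \int[gauss]_w pos_part 0 2 w < +oo.
Proof.
have m1 : measurable_fun [set: R] (fun x : R => (expR (- (-1 * x) - (-1) ^+ 2 / 2))%:E).
  apply/measurable_EFinP; apply: measurableT_comp => //.
  by apply: measurable_funB => //; apply: measurableT_comp.
apply: (@le_lt_trans _ _ (\int[gauss]_w
    (4%:E * (expR (- (-1 * w) - (-1) ^+ 2 / 2))%:E))).
  apply: ge0_le_integral => //; first exact: measurable_pos_part.
    by apply: emeasurable_funM.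
  move=> w _; rewrite lee_fin ge_max; apply/andP; split.
    by rewrite mulr_ge0// expR_ge0.
  have [w0|w0] := leP 0%R w.
    have := expR_ge1Dx (- (-1 * w) - (-1) ^+ 2 / 2).
    by rewrite sqrrN expr1n; lra.
  apply: (@le_trans _ _ 0%R); first by lra.
  by rewrite mulr_ge0// expR_ge0.
rewrite ge0_integralZl//.
rewrite [X in _ * X](_ : _ = 1) ?mule1 ?ltry//.
transitivity (\int[gauss]_w (cst 1 w * (expR (- (-1 * w) - (-1) ^+ 2 / 2))%:E)).
  by apply: eq_integral => w _; rewrite mul1e.
rewrite (@ge0_integral_normal_shift R (-1) (cst 1))//.
by rewrite integral_cst// [X in _ * X]probability_setT mule1.
Qed.

(** Ratio of the densities of two normal laws with unit variance at distance [s],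
    as a function of the component of the noise along the line of their means;
    a rejection has positive probability only if [s + 2 * w] is positive. *)
Definition accept_ratio (s w : R) : R := expR (- (s * w) - s ^+ 2 / 2).

Lemma accept_ratio_le1 s w : (0 < s)%R -> (accept_ratio s w <= 1)%R = (0 <= s + 2 * w)%R.
Proof.
move=> s0; rewrite expR_le1.
rewrite (_ : - (s * w) - s ^+ 2 / 2 = - (s * (s + 2 * w) / 2))%R; last by field.
by rewrite oppr_le0 pmulr_lge0 ?invr_gt0// pmulr_rge0.
Qed.

(** Reflecting the noise keeps the mean distance: the mass removed by the
    acceptances is, by the Cameron-Martin shift by [s] and symmetry, the mass
    that [s + 2 * w] puts on the negative axis.  So the left-hand side is the
    mean of [s + 2 * w].  All the integrands are kept nonnegative, and the common
    first absolute moment [M] is subtracted only at the end. *)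
Lemma mean_reflection (s : R) : (0 < s)%R ->
  \int[gauss]_w (`|s + 2 * w| * Num.max 0 (1 - accept_ratio s w))%:E = s%:E.
Proof.
move=> s0.
set E := LHS.
have mp : measurable_fun [set: R] (accept_ratio s).
  apply: measurableT_comp => //; apply: measurable_funB => //.
  by apply: measurableT_comp => //; exact: measurable_funM.
have mrej : measurable_fun [set: R]
    (fun w : R => (`|s + 2 * w| * Num.max 0 (1 - accept_ratio s w))%:E).
  apply/measurable_EFinP; apply: measurable_funM.
    by apply: measurableT_comp => //; apply: measurable_funD => //.
  by apply: measurable_maxr => //; exact: measurable_funB.
have p0 w : (0 < accept_ratio s w)%R by exact: expR_gt0.
pose A := \int[gauss]_w pos_part s 2 w.
pose B := \int[gauss]_w pos_part (- s) 2 w.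
pose M := \int[gauss]_w pos_part 0 2 w.
have EB : E + B = A.
  have -> : B = \int[gauss]_w (pos_part s 2 w * (accept_ratio s w)%:E).
    rewrite ge0_integral_normal_shift//.
    apply: eq_integral => w _; congr (Num.max _ _)%:E; ring.
  rewrite -ge0_integralD//; last 3 first.
  - by move=> w _; rewrite lee_fin mulr_ge0// le_max lexx.
  - by move=> w _; rewrite mule_ge0// lee_fin ltW.
  - apply: emeasurable_funM; first exact: measurable_pos_part.
    by apply/measurable_EFinP.
  apply: eq_integral => w _; rewrite -EFinM -EFinD; congr EFin.
  have [h|h] := leP 0%R (s + 2 * w)%R.
    have := h; rewrite -accept_ratio_le1// => h1.
    by rewrite ger0_norm// max_r ?subr_ge0//; ring.
  have : (1 < accept_ratio s w)%R by rewrite ltNge accept_ratio_le1// -ltNge.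
  by move=> h1; rewrite max_l ?subr_le0 ?ltW//; ring.
have AB : A + M = B + M + s%:E.
  have -> : A = \int[gauss]_w pos_part s (- 2) w by exact: pos_part_sym.
  have {2}-> : M = \int[gauss]_w pos_part 0 (- 2) w by exact: pos_part_sym.
  have -> : s%:E = \int[gauss]_w (s%:E).
    by rewrite integral_cst// [X in _ * X]probability_setT mule1.
  have s0E (w : R) : 0 <= s%:E :> \bar R by rewrite lee_fin ltW.
  have mBM : measurable_fun [set: R] (fun w => pos_part (- s) 2 w + pos_part 0 (- 2) w).
    exact: emeasurable_funD.
  rewrite -!ge0_integralD//.
  all: try exact: measurable_pos_part.
  all: try by move=> w _; rewrite ?adde_ge0 ?(s0E w).
  apply: eq_integral => w _; rewrite /pos_part -!EFinD; congr EFin.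
  have max0B (x : R) : (Num.max 0 x = x + Num.max 0 (- x))%R.
    have [x0|/ltW x0] := leP 0%R x.
      by rewrite max_l ?addr0// oppr_le0.
    by rewrite max_r ?subrr// oppr_ge0.
  rewrite (max0B (s + - 2 * w)%R) (max0B (0 + 2 * w)%R).
  have -> : (- (s + - 2 * w) = - s + 2 * w)%R by ring.
  have -> : (- (0 + 2 * w) = 0 + - 2 * w)%R by ring.
  by ring.
have Mfin : M \is a fin_num by rewrite ge0_fin_numE ?pos_part_fin//; exact: integral_ge0.
have BM : B <= M.
  apply: ge0_le_integral => //; [exact: measurable_pos_part..|].
  move=> w _; rewrite lee_fin ge_max !le_max lexx/=; apply/orP.
  have [h|h] := leP 0%R (2 * w)%R; [right|left]; lra.
have Bfin : B \is a fin_num.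
  rewrite ge0_fin_numE; last exact: integral_ge0.
  by apply: le_lt_trans BM _; exact: pos_part_fin.
have : A = B + s%:E.
  by move: AB; rewrite addeAC => /(congr1 (fun z => z - M)); rewrite !addeK.
rewrite -EB addeC => /(congr1 (fun z => z - B)).
by rewrite [in LHS]addeC addeK// [B + s%:E]addeC addeK.
Qed.

End reflected_gaussian.

(** * The universal constant *)
Section coupling_constant.
Variable R : realType.
Local Notation mu := (@lebesgue_measure R).
Local Notation phi := (@normal_pdf R 0 1).
Local Notation gauss := (@normal_prob R 0 1).
Local Notation I := (`[0, 2^-1]%classic : set R).
Local Notation J := (`[4^-1, 3 / 8]%classic : set R).

Definition gain_far (u : R) : R := u ^+ 2 * (1 - expR (u - 2^-1)) * phi u.
Definition gain_near (u : R) : R := u ^+ 3 * phi u.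

Lemma c0E : c0 R = 4 * Num.min (\int[mu]_(u in I) gain_far u)
                               ((1 - expR (-1)) * \int[mu]_(u in I) gain_near u).
Proof. by []. Qed.

Lemma continuous_phi : continuous phi.
Proof. by apply: continuous_normal_pdf; exact: oner_neq0. Qed.

Lemma continuous_gain_far : continuous gain_far.
Proof.
move=> x; apply: (@continuousM R R (fun u => u ^+ 2 * (1 - expR (u - 2^-1))) phi);
  last exact: continuous_phi.
apply: (@continuousM R R (fun u => u ^+ 2) (fun u => 1 - expR (u - 2^-1))).
  exact: exprn_continuous.
apply: cvgB; first exact: cvg_cst.
apply: continuous_comp; last exact: continuous_expR.
by apply: cvgB; [exact: cvg_id|exact: cvg_cst].
Qed.

Lemma continuous_gain_near : continuous gain_near.
Proof.
move=> x; apply: (@continuousM R R (fun u => u ^+ 3) phi); last exact: continuous_phi.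
exact: exprn_continuous.
Qed.

Lemma integrable_continuous_itv (f : R -> R) (a b : R) : continuous f ->
  mu.-integrable `[a, b] (EFin \o f).
Proof.
move=> cf; apply: continuous_compact_integrable; first exact: segment_compact.
exact: continuous_subspaceT.
Qed.

Lemma gain_far_ge0 u : I u -> 0 <= gain_far u.
Proof.
rewrite /= in_itv/= => /andP[u0 u1].
by rewrite !mulr_ge0 ?sqr_ge0 ?normal_pdf_ge0// subr_ge0 expR_le1 subr_le0.
Qed.

Lemma gain_near_ge0 u : I u -> 0 <= gain_near u.
Proof.
rewrite /= in_itv/= => /andP[u0 u1].
by rewrite mulr_ge0 ?exprn_ge0 ?normal_pdf_ge0.
Qed.

(** The interval from 1/4 to 3/8 is an arbitrary choice inside the domain, away
    from the zeros of the two integrands that define the constant. *)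
Lemma Rintegral_gt0 (f : R -> R) (m : R) : continuous f -> 0 < m ->
  (forall u, I u -> 0 <= f u) -> (forall u, 4^-1 <= u <= 3 / 8 -> m <= f u) ->
  0 < \int[mu]_(u in I) f u.
Proof.
move=> cf m0 f0 fm.
have sub : J `<=` I.
  by move=> u /=; rewrite !in_itv/= => /andP[u1 u2]; apply/andP; split; lra.
apply: (@lt_le_trans _ _ (m * 8^-1)); first by rewrite mulr_gt0.
have h1 : ((m * 8^-1)%:E <= \int[mu]_(u in I) (f u)%:E)%E.
  apply: (@le_trans _ _ (\int[mu]_(u in J) (f u)%:E)%E); last first.
    apply: ge0_subset_integral => //.
      exact: measurable_int (integrable_continuous_itv _ _ cf).
  apply: (@le_trans _ _ (\int[mu]_(u in J) (m%:E))%E).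
    rewrite integral_cst//= lebesgue_measure_itv/= lte_fin.
    have lt48 : (4^-1 : R) < 3 / 8 by lra.
    rewrite lt48 -EFinB -EFinM lee_fin ler_wpM2l ?(ltW m0)//.
    have -> : (3 / 8 - 4^-1 : R) = 8^-1 by field.
    by [].
  apply: ge0_le_integral => //.
  - by move=> u _; rewrite lee_fin ltW.
  - exact: measurable_int (integrable_continuous_itv _ _ cf).
rewrite -lee_fin /Rintegral fineK//.
exact: integrable_fin_num (integrable_continuous_itv _ _ cf).
Qed.

Lemma phi_ge (u : R) : 4^-1 <= u <= 3 / 8 -> phi 1 <= phi u.
Proof.
move=> /andP[u0 u1]; rewrite !normal_pdf01E ler_wpM2l ?normal_peak_ge0// ler_expR.
by rewrite expr1n ler_pM2r ?invr_gt0// lerN2; nra.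
Qed.

Lemma c0_gt0 : 0 < c0 R.
Proof.
have p1 : 0 < phi 1 by exact: normal_pdf01_gt0.
rewrite c0E mulr_gt0// lt_min; apply/andP; split.
  have e0 : 0 < 1 - expR (- 8^-1) :> R.
    by rewrite subr_gt0 expR_lt1 oppr_lt0 invr_gt0.
  apply: (@Rintegral_gt0 _ (4^-1 ^+ 2 * (1 - expR (- 8^-1)) * phi 1)).
  - exact: continuous_gain_far.
  - by rewrite !mulr_gt0// exprn_gt0.
  - exact: gain_far_ge0.
  - move=> u u01; have /andP[u0 u1] := u01.
    have q0 : 0 <= (4^-1 : R) by rewrite invr_ge0.
    have u2 : 4^-1 ^+ 2 <= u ^+ 2 by rewrite ler_pXn2r// nnegrE// (le_trans q0).
    apply: ler_pM; [|exact: ltW| |exact: phi_ge].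
      by rewrite mulr_ge0 ?exprn_ge0 ?(ltW e0).
    apply: ler_pM; [exact: exprn_ge0|exact: ltW|exact: u2|].
    by rewrite lerD2l lerN2 ler_expR; lra.
rewrite mulr_gt0 ?subr_gt0 ?expR_lt1 ?oppr_lt0//.
apply: (@Rintegral_gt0 _ (4^-1 ^+ 3 * phi 1)).
- exact: continuous_gain_near.
- by rewrite mulr_gt0// exprn_gt0.
- exact: gain_near_ge0.
- move=> u u01; have /andP[u0 u1] := u01.
  have q0 : 0 <= (4^-1 : R) by rewrite invr_ge0.
  apply: ler_pM; [exact: exprn_ge0|exact: ltW| |exact: phi_ge].
  by rewrite ler_pXn2r// nnegrE// (le_trans q0).
Qed.

(** A crude bound is enough, since it is only applied after multiplication by
    [7 / 970]. *)
Lemma c0_le4 : c0 R <= 4.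
Proof.
rewrite c0E -[leRHS]mulr1 ler_pM2l// ge_min; apply/orP; left.
rewrite -lee_fin /Rintegral fineK; last first.
  exact: integrable_fin_num (integrable_continuous_itv _ _ continuous_gain_far).
apply: (@le_trans _ _ (gauss I)); last exact: probability_le1.
apply: ge0_le_integral => //.
- by move=> u /gain_far_ge0; rewrite lee_fin.
- exact: measurable_int (integrable_continuous_itv _ _ continuous_gain_far).
- by apply: measurable_funTS; exact: measurable_normal_pdf01.
- move=> u; rewrite /= in_itv/= => /andP[u0 u1]; rewrite lee_fin.
  rewrite ler_piMl ?normal_pdf_ge0// mulr_ile1 ?sqr_ge0 ?exprn_ile1//.
  + by rewrite subr_ge0 expR_le1 subr_le0.
  + lra.
Qed.

End coupling_constant.

(** * Variance of the coupled distance on a one-sided window *)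
Section coupling_gain.
Variable R : realType.
Local Notation mu := (@lebesgue_measure R).
Local Notation phi := (@normal_pdf R 0 1).
Local Notation gauss := (@normal_prob R 0 1).
Local Notation I := (`[0, 2^-1]%classic : set R).

(** Squared fluctuation of the rescaled distance [s + 2 * w] around [s], weighted
    by the rejection probability. *)
Definition rejection_gain (s w : R) : R :=
  4 * w ^+ 2 * Num.max 0 (1 - accept_ratio s w).

Lemma rejection_gain_ge0 s w : 0 <= rejection_gain s w.
Proof.
by apply: mulr_ge0; [rewrite mulr_ge0 ?sqr_ge0|rewrite le_max lexx].
Qed.

Lemma measurable_accept_ratio s : measurable_fun [set: R] (accept_ratio s).
Proof.
apply: measurableT_comp => //; apply: measurable_funB => //.
by apply: measurableT_comp => //; exact: measurable_funM.
Qed.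

Lemma measurable_rejection_gain s : measurable_fun [set: R] (rejection_gain s).
Proof.
apply: measurable_funM; first exact: measurable_funM.
apply: measurable_maxr => //; apply: measurable_funB => //.
exact: measurable_accept_ratio.
Qed.

Lemma le_integral_normal_itv (f G : R -> R) (k : R) : continuous f -> 0 <= k ->
  measurable_fun [set: R] G -> (forall w, 0 <= G w) ->
  (forall u, I u -> 0 <= f u) -> (forall u, I u -> k * f u <= G u * phi u) ->
  ((k * \int[mu]_(u in I) f u)%:E <= \int[gauss]_w (\1_I w * G w)%:E)%E.
Proof.
move=> cf k0 mG G0 f0 fG.
have intf := @integrable_continuous_itv R f 0 2^-1 cf.
have phi0 w : 0 <= phi w by exact: normal_pdf_ge0.
rewrite EFinM fineK; last exact: integrable_fin_num intf.
rewrite -ge0_integralZl//; last first.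
  exact: measurable_int intf.
have mIG : measurable_fun [set: R] (fun w => \1_I w * G w).
  by apply: measurable_funM => //; apply: measurable_indic.
rewrite ge0_integral_normal//; last 2 first.
- exact/measurable_EFinP.
- by move=> w; rewrite lee_fin mulr_ge0.
rewrite integral_mkcond; apply: ge0_le_integral => //.
- by move=> w _; apply: erestrict_ge0 => u Iu; rewrite mule_ge0// lee_fin f0.
- apply/(measurable_restrictT _ _).1 => //.
  by apply: emeasurable_funM => //; exact: measurable_int intf.
- apply: emeasurable_funM; first exact/measurable_EFinP.
  exact: measurable_normal_pdf01.
- move=> w _; rewrite patchE; case: ifPn => [/set_mem Iw|_].
    by rewrite indicE mem_set// mul1r -!EFinM lee_fin fG.
  by rewrite mule_ge0// lee_fin ?mulr_ge0.
Qed.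

(** For overlapping laws only the values above the current distance keep enough
    mass: the rejection probability is of order [s * w] there. *)
Lemma near_gain (s : R) : 0 < s -> s <= 1 ->
  ((c0 R * s)%:E <= \int[gauss]_w (\1_I w * rejection_gain s w)%:E)%E.
Proof.
move=> s0 s1.
have e10 : 0 <= 1 - expR (-1) :> R by rewrite subr_ge0 expR_le1 oppr_le0.
apply: (@le_trans _ _ ((4 * s * (1 - expR (-1)) * \int[mu]_(u in I) gain_near u)%:E)).
  rewrite lee_fin c0E -!mulrA ler_pM2l// mulrC ler_pM2l//.
  by rewrite ge_min lexx orbT.
apply: le_integral_normal_itv.
- exact: continuous_gain_near.
- by rewrite !mulr_ge0// ltW.
- exact: measurable_rejection_gain.
- exact: rejection_gain_ge0.
- exact: gain_near_ge0.
move=> u; rewrite /= in_itv/= => /andP[u0 u1].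
rewrite /gain_near mulrA ler_wpM2r ?normal_pdf_ge0//.
rewrite (_ : _ * u ^+ 3 = 4 * u ^+ 2 * (s * u * (1 - expR (-1)))); last by ring.
rewrite ler_wpM2l ?mulr_ge0 ?sqr_ge0//.
rewrite le_max; apply/orP; right.
set z := s * u.
have z0 : 0 <= z by rewrite mulr_ge0// ltW.
have z1 : z <= 1 by rewrite mulr_ile1 ?(ltW s0)//; lra.
have h : accept_ratio s u <= expR (- z).
  by rewrite ler_expR gerBl mulr_ge0 ?sqr_ge0// invr_ge0.
(* convexity of the exponential between -1 and 0, from its tangents at - z *)
have h1 : z * expR (- z) <= expR (-1).
  rewrite (_ : -1 = (z - 1) + - z :> R); last by ring.
  rewrite expRD ler_wpM2r ?expR_ge0//.
  by apply: le_trans (expR_ge1Dx _); lra.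
have h2 : (1 + z) * expR (- z) <= 1.
  rewrite -[leRHS](expRxMexpNx_1 z) ler_wpM2r ?expR_ge0//.
  exact: expR_ge1Dx.
have h3 : z * (z * expR (- z)) <= z * expR (-1) by rewrite ler_wpM2l.
have h4 : (1 - z) * ((1 + z) * expR (- z)) <= (1 - z) * 1.
  by rewrite ler_wpM2l// subr_ge0.
have e : z * (z * expR (- z)) + (1 - z) * ((1 + z) * expR (- z)) = expR (- z) by ring.
lra.
Qed.

(** For well separated laws the window below the current distance is used; there
    the rejection probability is smallest for [s = 1]. *)
Lemma far_gain (s : R) : 1 <= s ->
  ((c0 R)%:E <= \int[gauss]_w (\1_I (- w) * rejection_gain s w)%:E)%E.
Proof.
move=> s1.
apply: (@le_trans _ _ ((4 * \int[mu]_(u in I) gain_far u)%:E)).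
  by rewrite lee_fin c0E ler_pM2l// ge_min lexx.
have mG : measurable_fun [set: R] (fun w => rejection_gain s (- w)).
  by apply: measurableT_comp => //; exact: measurable_rejection_gain.
apply: (@le_trans _ _ (\int[gauss]_w (\1_I w * rejection_gain s (- w))%:E)%E); last first.
  have mIG : measurable_fun [set: R] (fun w => (\1_I (- w) * rejection_gain s w)%:E).
    apply/measurable_EFinP; apply: measurable_funM; last exact: measurable_rejection_gain.
    by apply: measurableT_comp => //; apply: measurable_indic.
  rewrite -[leRHS]ge0_integral_normal_opp//; last first.
    by move=> w; rewrite lee_fin mulr_ge0// rejection_gain_ge0.
  by under [leRHS]eq_integral do rewrite opprK.
apply: le_integral_normal_itv => //.
- exact: continuous_gain_far.
- by move=> w; exact: rejection_gain_ge0.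
- exact: gain_far_ge0.
move=> u; rewrite /= in_itv/= => /andP[u0 u1].
rewrite /gain_far mulrA ler_wpM2r ?normal_pdf_ge0//.
rewrite /rejection_gain sqrrN mulrA ler_wpM2l ?mulr_ge0 ?sqr_ge0//.
rewrite /accept_ratio le_max; apply/orP; right; rewrite lerD2l lerN2 ler_expR.
have : 0 <= (s - 1) * ((s + 1) / 2 - u) by rewrite mulr_ge0//; lra.
have -> : (s - 1) * ((s + 1) / 2 - u) = (u - 2^-1) - (- (s * - u) - s ^+ 2 / 2).
  by field.
by rewrite subr_ge0.
Qed.

End coupling_gain.

(** * Euclidean norm and one drift step *)
Section euclidean.
Variables (R : realType) (d : nat).
Implicit Types (u v w : 'cV[R]_d) (a : R).

Lemma dotvC u v : dotv u v = dotv v u.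
Proof. by apply: eq_bigr => i _; rewrite mulrC. Qed.

Lemma dotvDl u v w : dotv (u + v) w = dotv u w + dotv v w.
Proof. by rewrite -big_split/=; apply: eq_bigr => i _; rewrite mxE mulrDl. Qed.

Lemma dotvZl a u v : dotv (a *: u) v = a * dotv u v.
Proof. by rewrite mulr_sumr; apply: eq_bigr => i _; rewrite mxE mulrA. Qed.

Lemma dotvDr u v w : dotv u (v + w) = dotv u v + dotv u w.
Proof. by rewrite dotvC dotvDl !(dotvC _ u). Qed.

Lemma dotvZr a u v : dotv u (a *: v) = a * dotv u v.
Proof. by rewrite dotvC dotvZl dotvC. Qed.

Lemma dotv_ge0 u : 0 <= dotv u u.
Proof. by apply: sumr_ge0 => i _; exact: sqr_ge0. Qed.

Lemma enorm_ge0 u : 0 <= enorm u.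
Proof. exact: sqrtr_ge0. Qed.

Lemma sqr_enorm u : enorm u ^+ 2 = dotv u u.
Proof. by rewrite sqr_sqrtr// dotv_ge0. Qed.

Lemma enormZ a u : enorm (a *: u) = `|a| * enorm u.
Proof.
by rewrite /enorm dotvZl dotvZr mulrA -expr2 sqrtrM ?sqr_ge0// sqrtr_sqr.
Qed.

Lemma enorm0 : enorm (0 : 'cV[R]_d) = 0.
Proof. by rewrite -[0 : 'cV_d](scale0r 0) enormZ normr0 mul0r. Qed.

Lemma enorm0_eq0 u : enorm u = 0 -> u = 0.
Proof.
move=> u0; have : dotv u u = 0 by rewrite -sqr_enorm u0 expr0n.
move/eqP; rewrite psumr_eq0; last by move=> i _; exact: sqr_ge0.
move=> /allP h; apply/matrixP => i j; rewrite ord1 mxE.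
have := h i (mem_index_enum _); rewrite /= mulf_eq0 orbb.
by move/eqP.
Qed.

Lemma enorm_gt0 u : u != 0 -> 0 < enorm u.
Proof.
move=> u0; rewrite lt_neqAle enorm_ge0 andbT eq_sym.
by apply: contra u0 => /eqP /enorm0_eq0 ->.
Qed.

Lemma cauchy_schwarz u v : dotv u v <= enorm u * enorm v.
Proof.
have [->|u0] := eqVneq u 0.
  by rewrite enorm0 mul0r -[0 : 'cV_d](scale0r 0) dotvZl mul0r.
have [->|v0] := eqVneq v 0.
  by rewrite enorm0 mulr0 -[0 : 'cV_d](scale0r 0) dotvZr mul0r.
have nu := enorm_gt0 u0; have nv := enorm_gt0 v0.
have := dotv_ge0 (enorm v *: u + (- enorm u) *: v).
rewrite !(dotvDl, dotvDr, dotvZl, dotvZr) -!sqr_enorm (dotvC v u).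
set c := dotv u v; set m := enorm u in nu *; set n := enorm v in nv *.
rewrite (_ : _ + _ = 2 * (m * n) * (m * n - c)); last by ring.
by rewrite pmulr_rge0 ?subr_ge0// !mulr_gt0.
Qed.

End euclidean.

(** The bounds on the distance [rh] after the drift step compare squares: only
    [rh ^+ 2] is polynomial in the data, and the one-sided conditions enter
    through the scalar product [c]. *)
Section drift_bounds.
Variables (R : realType) (d : nat) (b : 'cV[R]_d -> 'cV[R]_d) (h J K L : R).
Variables x y : 'cV[R]_d.
Hypotheses (h0 : 0 < h) (hJ : 0 <= J) (hK : 0 < K) (hL : 0 < L).
Hypothesis C3 : enorm (b x - b y) <= L * enorm (x - y).

Local Notation r := (enorm (x - y)).
Local Notation be := (enorm (b x - b y)).
Local Notation c := (dotv (x - y) (b x - b y)).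
Local Notation rh := (enorm (euler_drift b h x - euler_drift b h y)).

Lemma sqr_drift_dist : rh ^+ 2 = r ^+ 2 + 2 * h * c + h ^+ 2 * be ^+ 2.
Proof.
have -> : euler_drift b h x - euler_drift b h y = (x - y) + h *: (b x - b y).
  by rewrite /euler_drift scalerBr opprD addrACA.
rewrite !sqr_enorm; move: (x - y) (b x - b y) => u v.
rewrite !(dotvDl, dotvDr, dotvZl, dotvZr) (dotvC v u).
by ring.
Qed.

Let r0 : 0 <= r. Proof. exact: enorm_ge0. Qed.
Let be0 : 0 <= be. Proof. exact: enorm_ge0. Qed.
Let be2 : be ^+ 2 <= L ^+ 2 * r ^+ 2.
Proof. by rewrite -exprMn ler_pXn2r// nnegrE// mulr_ge0// ltW. Qed.

Lemma drift_dist_le_lipschitz : rh <= (1 + h * L) * r.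
Proof.
rewrite -(@ler_pXn2r _ 2)// ?nnegrE ?enorm_ge0//; last first.
  by rewrite mulr_ge0// addr_ge0// mulr_ge0// ltW.
rewrite sqr_drift_dist.
have hc : c <= L * r ^+ 2.
  apply: le_trans (cauchy_schwarz _ _) _.
  by rewrite expr2 mulrA (mulrC L) -mulrA ler_wpM2l.
have h1 : h * c <= h * (L * r ^+ 2) by rewrite ler_pM2l.
have h2 : h ^+ 2 * be ^+ 2 <= h ^+ 2 * (L ^+ 2 * r ^+ 2).
  by rewrite ler_wpM2l// sqr_ge0.
have -> : ((1 + h * L) * r) ^+ 2 =
  r ^+ 2 + 2 * (h * (L * r ^+ 2)) + h ^+ 2 * (L ^+ 2 * r ^+ 2) by ring.
by rewrite -[2 * h * c]mulrA lerD// lerD2l ler_pM2l.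
Qed.

Lemma drift_dist_le_onesided : c <= J * r ^+ 2 ->
  rh <= (1 + h * (J + L ^+ 2 * h / 2)) * r.
Proof.
move=> hc.
have m0 : 0 <= h * (J + L ^+ 2 * h / 2).
  have h00 := ltW h0.
  by rewrite mulr_ge0// addr_ge0// divr_ge0// mulr_ge0// sqr_ge0.
rewrite -(@ler_pXn2r _ 2)// ?nnegrE ?enorm_ge0//; last first.
  by rewrite mulr_ge0// addr_ge0.
rewrite sqr_drift_dist.
have h1 : h * c <= h * (J * r ^+ 2) by rewrite ler_pM2l.
have h2 : h ^+ 2 * be ^+ 2 <= h ^+ 2 * (L ^+ 2 * r ^+ 2).
  by rewrite ler_wpM2l// sqr_ge0.
have h3 : 0 <= (h * (J + L ^+ 2 * h / 2) * r) ^+ 2 by exact: sqr_ge0.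
have -> : ((1 + h * (J + L ^+ 2 * h / 2)) * r) ^+ 2 =
  r ^+ 2 + 2 * (h * (J * r ^+ 2)) + h ^+ 2 * (L ^+ 2 * r ^+ 2) +
  (h * (J + L ^+ 2 * h / 2) * r) ^+ 2 by field.
by rewrite -[2 * h * c]mulrA -[leLHS]addr0 lerD// lerD// lerD2l ler_pM2l.
Qed.

Lemma drift_dist_ge : h * L <= 1 -> (1 - h * L) * r <= rh.
Proof.
move=> hL1.
apply: (@le_trans _ _ (r - h * be)).
  by rewrite mulrBl mul1r lerD2l lerN2 -mulrA ler_pM2l.
have [neg|pos] := leP (r - h * be) 0; first exact: le_trans neg (enorm_ge0 _).
rewrite -(@ler_pXn2r _ 2)// ?nnegrE ?enorm_ge0 ?(ltW pos)//.
rewrite sqr_drift_dist.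
have hc : - c <= r * be.
  have := cauchy_schwarz (x - y) (-1 *: (b x - b y)).
  by rewrite dotvZr mulN1r enormZ normrN1 mul1r.
have h1 : h * - c <= h * (r * be) by rewrite ler_pM2l.
have -> : (r - h * be) ^+ 2 = r ^+ 2 + 2 * - (h * (r * be)) + h ^+ 2 * be ^+ 2 by ring.
rewrite lerD2r lerD2l -mulrA ler_pM2l// lerNl.
by rewrite -mulrN.
Qed.

Lemma drift_dist_le_contractive : 0 < r -> h * L ^+ 2 <= K -> c <= - K * r ^+ 2 ->
  rh <= (1 - h * K / 2) * r.
Proof.
move=> rp hLK hc.
have h1 : h * c <= h * (- K * r ^+ 2) by rewrite ler_pM2l.
have h2 : h ^+ 2 * be ^+ 2 <= h * K * r ^+ 2.
  apply: (@le_trans _ _ (h ^+ 2 * (L ^+ 2 * r ^+ 2))).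
    by rewrite ler_wpM2l// sqr_ge0.
  rewrite (_ : h ^+ 2 * (L ^+ 2 * r ^+ 2) = h * (h * L ^+ 2) * r ^+ 2); last by ring.
  by rewrite ler_wpM2r ?sqr_ge0// ler_pM2l.
have rh2 : rh ^+ 2 <= (1 - h * K) * r ^+ 2.
  rewrite sqr_drift_dist.
  have -> : (1 - h * K) * r ^+ 2 =
    r ^+ 2 + 2 * (h * (- K * r ^+ 2)) + h * K * r ^+ 2 by ring.
  by rewrite -[2 * h * c]mulrA lerD// lerD2l ler_pM2l.
have hK1 : 0 <= 1 - h * K.
  by have := le_trans (sqr_ge0 rh) rh2; rewrite pmulr_lge0// exprn_gt0.
have hKp : 0 < h * K by rewrite mulr_gt0.
rewrite -(@ler_pXn2r _ 2)// ?nnegrE ?enorm_ge0//; last first.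
  by rewrite mulr_ge0//; lra.
apply: le_trans rh2 _; rewrite exprMn ler_wpM2r ?sqr_ge0//.
rewrite -subr_ge0.
have -> : (1 - h * K / 2) ^+ 2 - (1 - h * K) = (h * K / 2) ^+ 2 by field.
exact: sqr_ge0.
Qed.

End drift_bounds.

(** * The coupled distance as a function of one noise component *)
Section coupled_distance.
Variables (R : realType) (d : nat) (b : 'cV[R]_d -> 'cV[R]_d) (h : R).
Variables x y : 'cV[R]_d.
Hypothesis h0 : 0 < h.

Local Notation xh := (euler_drift b h x).
Local Notation yh := (euler_drift b h y).
Local Notation rh := (enorm (xh - yh)).
Local Notation e := (unit_direction xh yh).
Local Notation s := (rh / Num.sqrt h).

Let sh0 : 0 < Num.sqrt h. Proof. by rewrite sqrtr_gt0. Qed.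
Let shn0 : Num.sqrt h != 0. Proof. by rewrite gt_eqF. Qed.
Let sh2 : Num.sqrt h ^+ 2 = h. Proof. by rewrite sqr_sqrtr// ltW. Qed.

Lemma coupled_distance_eq z u : xh = yh ->
  enorm (coupling_X b h x z - coupling_Y b h x y z u) = 0.
Proof.
move=> xy; rewrite /coupling_Y /unit_direction xy eqxx mul0mx scaler0 subr0 mul1mx.
by rewrite /coupling_X xy; case: ifP => _; rewrite subrr enorm0.
Qed.

Hypothesis xy : xh != yh.

Let rh0 : 0 < rh. Proof. by rewrite enorm_gt0// subr_eq0. Qed.
Let rhn0 : rh != 0. Proof. by rewrite gt_eqF. Qed.

Lemma unit_directionE : xh - yh = rh *: e.
Proof. by rewrite /unit_direction (negbTE xy) scalerA divff// scale1r. Qed.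

Lemma unit_direction_sqr : \sum_(i < d) e i 0 ^+ 2 = 1.
Proof.
transitivity (dotv e e); first by apply: eq_bigr => i _; rewrite expr2.
apply: (mulfI (expf_neq0 2 rhn0)); rewrite mulr1.
rewrite [in RHS]sqr_enorm [in RHS]unit_directionE dotvZl dotvZr mulrA -expr2.
by [].
Qed.

(** The normalising factors cancel, and the exponents differ by a function of the
    component of the noise along the line joining the means. *)
Lemma gaussian_pdf_ratio z :
  gaussian_pdf yh h (coupling_X b h x z) / gaussian_pdf xh h (coupling_X b h x z) =
  accept_ratio s (dotv e z).
Proof.
rewrite /gaussian_pdf -prodf_div.
transitivity (\prod_(i < d)
    expR (- (s * (e i 0 * z i 0)) - s ^+ 2 / 2 * e i 0 ^+ 2)).
  apply: eq_bigr => i _; rewrite !normal_pdfE// -mulf_div divff; last first.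
    by rewrite gt_eqF// normal_peak_gt0.
  rewrite mul1r /normal_fun -expRB; congr expR.
  have -> : coupling_X b h x z i 0 = xh i 0 + Num.sqrt h * z i 0 by rewrite !mxE.
  have -> : yh i 0 = xh i 0 - rh * e i 0.
    move: unit_directionE; move: rh e xh yh => a w p q E.
    have := congr1 (fun m : 'cV_d => m i 0) E; rewrite !mxE => <-.
    by rewrite opprB addrC subrK.
  rewrite -mulr_natr.
  by field.
rewrite -expR_sum; congr expR.
rewrite big_split/= sumrN -!mulr_sumr sumrN -mulr_sumr unit_direction_sqr mulr1.
by [].
Qed.

(** The reflection fixes the noise orthogonally to [e], where the two processes
    move in parallel, and doubles the relative motion along [e]. *)
Lemma coupled_distanceE z u :
  enorm (coupling_X b h x z - coupling_Y b h x y z u) =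
  if u <= accept_ratio s (dotv e z) then 0
  else `|rh + 2 * Num.sqrt h * dotv e z|.
Proof.
rewrite /coupling_Y gaussian_pdf_ratio; case: ifP => _.
  by rewrite subrr enorm0.
have -> : coupling_X b h x z -
    (yh + Num.sqrt h *: ((1%:M - 2 *: (e *m e^T)) *m z)) =
    (rh + 2 * Num.sqrt h * dotv e z) *: e.
  rewrite mulmxBl mul1mx -scalemxAl -mulmxA.
  have -> : e^T *m z = (dotv e z)%:M.
    apply/matrixP => i j; rewrite !ord1 !mxE eqxx mulr1n.
    by apply: eq_bigr => k _; rewrite mxE.
  rewrite mul_mx_scalar /coupling_X opprD addrACA [RHS]scalerDl -unit_directionE.
  congr (_ + _); rewrite scalerBr opprB addrCA subrr addr0 !scalerA.
  by congr (_ *: _); ring.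
rewrite enormZ [enorm e](_ : _ = 1) ?mulr1//.
rewrite /enorm (_ : dotv e e = 1) ?sqrtr1//.
by rewrite -unit_direction_sqr; apply: eq_bigr => i _; rewrite expr2.
Qed.

End coupled_distance.

(** * Expected profile of the coupled distance *)
Section expected_profile.
Context disp (T : measurableType disp) (R : realType) (P : probability T R).
Variables (d : nat) (Z : {RV P >-> d.-tuple R}) (U : {RV P >-> R}).
Hypotheses (gaussZ : std_gaussian_vector Z) (unifU : uniform01 U).
Hypothesis indep : independent_RV Z U.
Variables (b : 'cV[R]_d -> 'cV[R]_d) (h : R) (x y : 'cV[R]_d).
Hypothesis h0 : 0 < h.
Variables (q a : R).
Hypotheses (q0 : 0 < q) (a0 : 0 <= a).
Local Notation gauss := (@normal_prob R 0 1).
Local Notation rh := (enorm (euler_drift b h x - euler_drift b h y)).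

Definition coupled_dist (t : T) : R :=
  enorm (coupling_X b h x (col_of_tuple (Z t)) -
         coupling_Y b h x y (col_of_tuple (Z t)) (U t)).

Lemma measurable_profile : measurable_fun [set: R] (profile q a).
Proof.
have ms : measurable_fun [set: R] (slope q a).
  by apply: continuous_measurable_fun; exact: continuous_slope.
apply: measurable_funD.
  by apply: measurable_funM => //; exact: measurable_funB.
apply: measurable_funM => //; apply: measurable_funB => //.
exact: measurable_minr.
Qed.

(** Integrating the tangent inequality at [rh]: the linear term has mean zero by
    [mean_reflection], so only the improvement [k * (4 * w ^+ 2)] on the window
    [A] remains.  On acceptance the distance is 0, where the tangent lies above
    the profile by [C]; weighting by the rejection probability [om] loses
    nothing more than [om <= 1] on [C].  Taking [A] empty gives Jensen's
    inequality. *)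
Lemma expected_profile_le (A : set R) (k m : R) :
  euler_drift b h x != euler_drift b h y ->
  measurable A -> 0 <= k -> 0 <= m ->
  (m%:E <= \int[gauss]_w (\1_A w * rejection_gain (rh / Num.sqrt h) w)%:E)%E ->
  (forall w, profile q a `|rh + 2 * Num.sqrt h * w| + k * (\1_A w * (4 * w ^+ 2)) <=
     profile q a rh + slope q a rh * (`|rh + 2 * Num.sqrt h * w| - rh)) ->
  (\int[P]_t (profile q a (coupled_dist t))%:E <= (profile q a rh - k * m)%:E)%E.
Proof.
move=> xy mA k0 m0 mgain gain.
set s := rh / Num.sqrt h in mgain *.
have sh0 : 0 < Num.sqrt h by rewrite sqrtr_gt0.
have rh0 : 0 < rh by rewrite enorm_gt0// subr_eq0.
have s0 : 0 < s by rewrite divr_gt0.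
pose e i := unit_direction (euler_drift b h x) (euler_drift b h y) i 0.
have e1 : \sum_(i < d) e i ^+ 2 = 1 by exact: unit_direction_sqr.
pose rho (w : R) : R := `|rh + 2 * Num.sqrt h * w|.
pose om (w : R) : R := Num.max 0 (1 - accept_ratio s w).
have om0 w : 0 <= om w by rewrite le_max lexx.
have om1 w : om w <= 1.
  by rewrite ge_max ler01/= lerBlDr lerDl expR_ge0.
have rho0 w : 0 <= rho w by exact: normr_ge0.
have macc := @measurable_accept_ratio R s.
have mom : measurable_fun [set: R] om.
  by apply: measurable_maxr => //; exact: measurable_funB.
have mrho : measurable_fun [set: R] rho.
  by apply: measurableT_comp => //; apply: measurable_funD => //; exact: measurable_funM.
have mprho : measurable_fun [set: R] (fun w => profile q a (rho w)).
  by apply: measurableT_comp => //; exact: measurable_profile.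
have prof0 w : 0 <= profile q a (rho w) by exact: profile_ge0.
have -> : (\int[P]_t (profile q a (coupled_dist t))%:E =
    \int[gauss]_w (profile q a (rho w) * om w)%:E)%E.
  rewrite -(integral_rejection gaussZ unifU indep e1 macc _ mprho)//; last first.
    by move=> w; exact: expR_ge0.
  apply: eq_integral => t _; rewrite /coupled_dist coupled_distanceE//.
  have -> : dotv (unit_direction (euler_drift b h x) (euler_drift b h y))
      (col_of_tuple (Z t)) = linear_image Z e t.
    by apply: eq_bigr => i _; rewrite mxE.
  by case: ifP => _ //; rewrite profile0.
pose C := profile q a rh - slope q a rh * rh.
have C0 : 0 <= C by rewrite subr_ge0 slope_mul_le_profile.
have S0 : 0 <= slope q a rh by rewrite ltW// slope_gt0.
pose g w := \1_A w * rejection_gain s w.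
have g0 w : 0 <= g w by rewrite mulr_ge0// rejection_gain_ge0.
have mg : measurable_fun [set: R] g.
  apply: measurable_funM; last exact: measurable_rejection_gain.
  by apply: measurable_indic.
have key w : profile q a (rho w) * om w + k * g w <=
    C + slope q a rh * Num.sqrt h * (`|s + 2 * w| * om w).
  have -> : slope q a rh * Num.sqrt h * (`|s + 2 * w| * om w) =
      slope q a rh * rho w * om w.
    have -> : rho w = Num.sqrt h * `|s + 2 * w|.
      rewrite /rho -{2}(gtr0_norm sh0) -normrM; congr `|_|.
      by rewrite /s; field; rewrite gt_eqF.
    by ring.
  have -> : k * g w = k * (\1_A w * (4 * w ^+ 2)) * om w.
    by rewrite /g /rejection_gain -/(om w); ring.
  rewrite -mulrDl.
  apply: (@le_trans _ _ ((C + slope q a rh * rho w) * om w)).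
    rewrite ler_wpM2r//; apply: le_trans (gain w) _.
    by rewrite le_eqVlt; apply/orP; left; apply/eqP; rewrite /C /rho; ring.
  by rewrite mulrDl lerD2r ler_piMr.
have : (\int[gauss]_w (profile q a (rho w) * om w)%:E +
    k%:E * \int[gauss]_w (g w)%:E <= (profile q a rh)%:E)%E.
  have mg' : measurable_fun [set: R] (fun w => (g w)%:E) by exact/measurable_EFinP.
  have mpo : measurable_fun [set: R] (fun w => (profile q a (rho w) * om w)%:E).
    by apply/measurable_EFinP; exact: measurable_funM.
  have mabs : measurable_fun [set: R] (fun w => (`|s + 2 * w| * om w)%:E).
    apply/measurable_EFinP; apply: measurable_funM => //.
    by apply: measurableT_comp => //; apply: measurable_funD => //; exact: measurable_funM.
  have c0 : 0 <= slope q a rh * Num.sqrt h by rewrite mulr_ge0// ltW.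
  rewrite -ge0_integralZl//; last by move=> w _; rewrite lee_fin.
  rewrite -ge0_integralD//; last 3 first.
  - by move=> w _; rewrite lee_fin mulr_ge0.
  - by move=> w _; rewrite mule_ge0// lee_fin.
  - exact: emeasurable_funM.
  have -> : ((profile q a rh)%:E = \int[gauss]_w
      (C%:E + (slope q a rh * Num.sqrt h)%:E * (`|s + 2 * w| * om w)%:E))%E.
    rewrite ge0_integralD//; last 2 first.
    - by move=> w _; rewrite mule_ge0// lee_fin mulr_ge0.
    - exact: emeasurable_funM.
    rewrite ge0_integralZl//; last by move=> w _; rewrite lee_fin mulr_ge0.
    rewrite mean_reflection// integral_cst// [X in (_ * X + _)%E]probability_setT.
    rewrite mule1 -EFinM -EFinD; congr EFin.
    by rewrite /C /s; field; rewrite gt_eqF.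
  apply: ge0_le_integral => //.
  - move=> w _; apply: adde_ge0; first by rewrite lee_fin mulr_ge0.
    by rewrite -EFinM lee_fin mulr_ge0.
  - by apply: emeasurable_funD => //; exact: emeasurable_funM.
  - by apply: emeasurable_funD => //; exact: emeasurable_funM.
  - by move=> w _; rewrite -!EFinM -!EFinD lee_fin; exact: key.
move=> H; rewrite EFinB leeBrDr//; apply: le_trans H; rewrite leeD2l//.
by rewrite EFinM lee_wpmul2l// lee_fin.
Qed.

End expected_profile.

(** * Balancing drift, concavity and rate *)
Section contraction_rate.
Variables (R : realType) (c K L Lam Rad h : R).
Hypotheses (c_gt0 : 0 < c) (c_le4 : c <= 4).
Hypotheses (hK : 0 < K) (hL : 0 < L) (hRad : 0 < Rad) (h0 : 0 < h).
Hypotheses (Lam_gt0 : 0 < Lam) (Lam_le_L : Lam <= L).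
Hypothesis h_le_L : h * L <= 1 / 6.
Hypothesis h_le_Rad : 3 * h <= Rad ^+ 2.
Hypothesis h_le_c : 970 * (h * L ^+ 2 * Rad ^+ 2) <= c ^+ 2.

Local Notation r1 := ((1 + h * L) * Rad).
Local Notation q := (7 * c^-1 * Lam * Rad).
Local Notation F := (profile q r1).
Local Notation S := (slope q r1).
Local Notation X := (49 / (6 * c) * Lam * Rad ^+ 2).
Local Notation c2 :=
  (Num.min (K / 2) (245 / (24 * c) * Lam ^+ 2 * Rad ^+ 2) * expR (- X)).

Let c_neq0 : c != 0. Proof. by rewrite gt_eqF. Qed.

Lemma rate_q_gt0 : 0 < q.
Proof.
by apply: mulr_gt0 => //; apply: mulr_gt0 => //; rewrite mulr_gt0// invr_gt0.
Qed.

Let hL_gt0 : 0 < h * L. Proof. by rewrite mulr_gt0. Qed.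

Lemma Rad_le_r1 : Rad <= r1.
Proof. by rewrite ler_peMl ?(ltW hRad)// lerDl ltW. Qed.

Lemma r1_gt0 : 0 < r1. Proof. exact: lt_le_trans Rad_le_r1. Qed.

Let X_E : X = 7 / 6 * (q * Rad). Proof. by field. Qed.

Lemma q_r1_le : q * r1 <= X.
Proof.
rewrite X_E mulrCA; apply: ler_wpM2r; last by move: h_le_L; lra.
by rewrite mulr_ge0 ?(ltW rate_q_gt0) ?(ltW hRad).
Qed.

Lemma rate_le_K : c2 <= K / 2 * expR (- X).
Proof. by rewrite ler_wpM2r ?expR_ge0// ge_min lexx. Qed.

(** In terms of the exponent [X] the rate is a multiple of [X * expR (- X)], which
    bounds it both by [Lam] and by the slope of the profile. *)
Lemma rate_le_X : c2 <= 5 / 4 * Lam * (X * expR (- X)).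
Proof.
rewrite [leRHS]mulrA ler_wpM2r ?expR_ge0// ge_min; apply/orP; right.
by rewrite le_eqVlt; apply/orP; left; apply/eqP; field.
Qed.

Lemma rate_le_Lam : c2 <= 5 / 8 * Lam.
Proof.
apply: le_trans rate_le_X _.
have -> : 5 / 8 * Lam = 5 / 4 * Lam * 2^-1 by field.
rewrite ler_wpM2l ?mulr_expRN_le_half// mulr_ge0 ?(ltW Lam_gt0)//.
Qed.

Lemma expRX_le_slope r : expR (- X) <= S r.
Proof.
rewrite ler_expR lerN2; apply: le_trans q_r1_le.
by rewrite ler_pM2l ?rate_q_gt0// ge_min lexx orbT.
Qed.

Lemma sqrt_h_le : 17 / 10 * Num.sqrt h <= Rad.
Proof.
rewrite -(@ler_pXn2r _ 2)// ?nnegrE ?(ltW hRad) ?mulr_ge0 ?sqrtr_ge0//.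
rewrite exprMn sqr_sqrtr ?(ltW h0)//.
apply: le_trans h_le_Rad; rewrite ler_wpM2r ?(ltW h0)//.
by rewrite expr2; lra.
Qed.

Lemma q_sqrt_h_le : q * Num.sqrt h <= 1 / 4.
Proof.
have Ls : L * Rad * Num.sqrt h <= c / 28.
  rewrite -(@ler_pXn2r _ 2)// ?nnegrE; last 2 first.
  - by rewrite !mulr_ge0 ?sqrtr_ge0 ?(ltW hL) ?(ltW hRad).
  - by rewrite divr_ge0// ltW.
  rewrite !exprMn sqr_sqrtr ?(ltW h0)//.
  have -> : L ^+ 2 * Rad ^+ 2 * h = h * L ^+ 2 * Rad ^+ 2 by ring.
  have : 0 <= h * L ^+ 2 * Rad ^+ 2.
    by apply: mulr_ge0; [apply: mulr_ge0; [exact: ltW|]|]; exact: sqr_ge0.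
  (* 28 * 28 = 784 <= 970 *)
  rewrite (_ : 28^-1 ^+ 2 = 784^-1); last by field.
  by move: h_le_c; lra.
have Lams : Lam * Rad * Num.sqrt h <= c / 28.
  by apply: le_trans Ls; rewrite ler_wpM2r ?sqrtr_ge0// ler_wpM2r ?(ltW hRad).
have -> : q * Num.sqrt h = 7 / c * (Lam * Rad * Num.sqrt h) by field.
apply: (@le_trans _ _ (7 / c * (c / 28))).
  by rewrite ler_wpM2l// divr_ge0// ltW.
by rewrite le_eqVlt; apply/orP; left; apply/eqP; field.
Qed.

Lemma q_drift_le r : 0 <= r -> r <= Rad -> q * (h * Lam * r) <= 3 / 100.
Proof.
move=> r0 rR; have L0 := ltW Lam_gt0.
have LL : Lam ^+ 2 <= L ^+ 2 by rewrite ler_pXn2r ?nnegrE ?(ltW hL)// Lam_le_L.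
have h1 : h * Lam ^+ 2 * (Rad * r) <= h * L ^+ 2 * Rad ^+ 2.
  apply: ler_pM; [by rewrite mulr_ge0 ?sqr_ge0 ?(ltW h0)|by rewrite mulr_ge0 ?(ltW hRad)| |].
    by rewrite ler_pM2l.
  by rewrite expr2 ler_pM2l.
have -> : q * (h * Lam * r) = 7 / c * (h * Lam ^+ 2 * (Rad * r)) by field.
apply: (@le_trans _ _ (7 / c * (c ^+ 2 / 970))).
  rewrite ler_wpM2l ?divr_ge0 ?(ltW c_gt0)//; apply: le_trans h1 _.
  by move: h_le_c; lra.
have -> : 7 / c * (c ^+ 2 / 970) = 7 / 970 * c by field.
by move: c_le4; lra.
Qed.

Lemma drift_tangent rh r : 0 <= r -> rh <= (1 + h * Lam) * r ->
  F rh <= F r + S r * (h * Lam * r).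
Proof.
move=> r0 hrh.
apply: le_trans (profile_tangent _ rate_q_gt0 r rh) _.
rewrite lerD2l ler_wpM2l ?(ltW (slope_gt0 _ _ _))//.
by move: hrh; rewrite mulrDl mul1r; lra.
Qed.

Lemma slope_drift rh r : 0 <= r -> r <= Rad -> rh <= (1 + h * Lam) * r ->
  97 / 100 * S r <= S rh.
Proof.
move=> r0 rR hrh.
apply: (@le_trans _ _ (expR (- (q * (h * Lam * r))) * S r)).
  rewrite ler_wpM2r ?(ltW (slope_gt0 _ _ _))//.
  apply: le_trans (expR_ge1Dx _).
  by have := q_drift_le r0 rR; lra.
rewrite /slope -expRD ler_expR (min_l (le_trans rR Rad_le_r1)).
rewrite -opprD -mulrDr lerN2 ler_pM2l ?rate_q_gt0//.
apply: (@le_trans _ _ rh); first by rewrite ge_min lexx.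
by move: hrh; rewrite mulrDl mul1r addrC.
Qed.

Lemma contraction_trivial : c2 * h <= 1.
Proof.
apply: (@le_trans _ _ (5 / 8 * Lam * h)); first by rewrite ler_pM2r// rate_le_Lam.
have : Lam * h <= L * h by rewrite ler_pM2r// Lam_le_L.
by rewrite -mulrA; move: h_le_L; rewrite (mulrC h); lra.
Qed.

(** Outside the ball the drift contracts, and a concave profile with slope at
    least [expR (- X)] keeps a share [expR (- X)] of the contraction. *)
Lemma contraction_large rh r : Rad <= r -> rh <= (1 - h * K / 2) * r ->
  F rh <= (1 - c2 * h) * F r.
Proof.
move=> rR hrh; have r0 : 0 <= r by apply: le_trans rR; exact: ltW.
apply: le_trans (profile_tangent _ rate_q_gt0 r rh) _.
have F0 := profile_ge0 rate_q_gt0 (ltW r1_gt0) r0.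
have Fr := profile_le_id rate_q_gt0 (ltW r1_gt0) r.
have S0 := slope_gt0 q r1 r.
have e : S r * (rh - r) <= S r * (- (h * K / 2) * r).
  by rewrite ler_pM2l//; move: hrh; rewrite mulrBl mul1r; lra.
suff : c2 * h * F r <= S r * (h * K / 2 * r) by move: e; rewrite mulNr mulrN; lra.
apply: (@le_trans _ _ (K / 2 * expR (- X) * h * F r)).
  by rewrite ler_wpM2r// ler_pM2r// rate_le_K.
have -> : S r * (h * K / 2 * r) = K / 2 * S r * h * r by ring.
apply: ler_pM => //; first by rewrite !mulr_ge0 ?expR_ge0 ?(ltW h0) ?(ltW hK).
by rewrite ler_pM2r// ler_wpM2l ?expRX_le_slope// divr_ge0// ltW.
Qed.

(** The drift costs at most [Lam * Rad * h * S r].  The choice of [q] makes the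
    gain 21/8 of this amount, and the rate needs 35/24 of it. *)
Lemma contraction_far rh r : 0 <= r -> r <= Rad -> rh <= (1 + h * Lam) * r ->
  F rh - 3 / 8 * q * S rh * h * c <= (1 - c2 * h) * F r.
Proof.
move=> r0 rR hrh; have L0 := ltW Lam_gt0.
have S0 := slope_gt0 q r1 r; have S97 := slope_drift r0 rR hrh.
have F0 := profile_ge0 rate_q_gt0 (ltW r1_gt0) r0.
have tang := drift_tangent r0 hrh.
have LR0 : 0 <= Lam * Rad * h by rewrite !mulr_ge0 ?(ltW hRad) ?(ltW h0).
have -> : 3 / 8 * q * S rh * h * c = 21 / 8 * (Lam * Rad * h * S rh) by field.
have g1 : 97 / 100 * (Lam * Rad * h * S r) <= Lam * Rad * h * S rh.
  by rewrite mulrCA ler_wpM2l.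
have d1 : S r * (h * Lam * r) <= Lam * Rad * h * S r.
  rewrite mulrC ler_wpM2r ?(ltW S0)//.
  by rewrite (_ : Lam * Rad * h = h * Lam * Rad) ?ler_wpM2l ?mulr_ge0 ?(ltW h0)//; ring.
have qF : q * F r <= 1.
  have qn0 : q != 0 by rewrite gt_eqF// rate_q_gt0.
  by rewrite (profile_small _ (le_trans rR Rad_le_r1)) mulrC divfK// gerBl.
have c2F : c2 * h * F r <= 35 / 24 * (Lam * Rad * h * S r).
  apply: (@le_trans _ _ (5 / 4 * Lam * (X * expR (- X)) * h * F r)).
    by rewrite ler_wpM2r// ler_pM2r// rate_le_X.
  have -> : 5 / 4 * Lam * (X * expR (- X)) * h * F r =
      35 / 24 * (Lam * Rad * h * (expR (- X) * (q * F r))).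
    by move: (expR _) (F r) => e f; field.
  rewrite ler_wpM2l ?divr_ge0// ler_wpM2l//.
  apply: (@le_trans _ _ (expR (- X) * 1)); first by rewrite ler_wpM2l ?expR_ge0.
  by rewrite mulr1 expRX_le_slope.
have : 0 <= Lam * Rad * h * S r by rewrite mulr_ge0// ltW.
by rewrite mulrBl mul1r; lra.
Qed.

(** For small [rh] the gain is proportional to [rh], like the cost of the drift;
    [Rad] exceeds [sqrt h] by enough for the gain to dominate. *)
Lemma contraction_near rh r : 0 <= r -> r <= Rad -> rh <= (1 + h * Lam) * r ->
  (1 - h * L) * r <= rh -> rh <= Num.sqrt h ->
  F rh - 1 / 4 * q * S rh * h * (c * (rh / Num.sqrt h)) <= (1 - c2 * h) * F r.
Proof.
move=> r0 rR hrh rhl rhs; have L0 := ltW Lam_gt0.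
have sh0 : 0 < Num.sqrt h by rewrite sqrtr_gt0.
have shn0 : Num.sqrt h != 0 by rewrite gt_eqF.
have S0 := slope_gt0 q r1 r; have S97 := slope_drift r0 rR hrh.
have F0 := profile_ge0 rate_q_gt0 (ltW r1_gt0) r0.
have Fr := profile_le_id rate_q_gt0 (ltW r1_gt0) r.
have tang := drift_tangent r0 hrh.
have rh56 : 5 / 6 * r <= rh.
  by apply: le_trans rhl; rewrite ler_wpM2r//; move: h_le_L; lra.
have Rs : 17 / 12 * r <= Rad * (rh / Num.sqrt h).
  apply: (@le_trans _ _ (17 / 10 * Num.sqrt h * (rh / Num.sqrt h))).
    have -> : 17 / 10 * Num.sqrt h * (rh / Num.sqrt h) = 17 / 10 * rh by field.
    by lra.
  by rewrite ler_wpM2r ?sqrt_h_le// divr_ge0 ?(ltW sh0)//; lra.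
have Lrh0 : 0 <= Lam * h by rewrite mulr_ge0// ltW.
have -> : 1 / 4 * q * S rh * h * (c * (rh / Num.sqrt h)) =
    7 / 4 * (Lam * h * (Rad * (rh / Num.sqrt h)) * S rh).
  by move: (rh / _) => u; field.
have g1 : Lam * h * (17 / 12 * r) * (97 / 100 * S r) <=
    Lam * h * (Rad * (rh / Num.sqrt h)) * S rh.
  apply: ler_pM => //; last by rewrite ler_wpM2l.
  - by rewrite mulr_ge0// mulr_ge0.
  - by rewrite mulr_ge0// ltW.
have Sr7 : 7 / 10 <= S r.
  rewrite /slope (min_l (le_trans rR Rad_le_r1)).
  apply: le_trans (expR_ge1Dx _).
  have : q * r <= q * (6 / 5 * Num.sqrt h).
    by rewrite ler_pM2l ?rate_q_gt0//; lra.
  by have := q_sqrt_h_le; lra.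
have c2F : c2 * h * F r <= 5 / 8 * (Lam * h * r).
  apply: (@le_trans _ _ (5 / 8 * Lam * h * r)); last by rewrite !mulrA.
  apply: (@le_trans _ _ (5 / 8 * Lam * h * F r)).
    by rewrite ler_wpM2r// ler_pM2r// rate_le_Lam.
  by rewrite ler_wpM2l// mulr_ge0 ?(ltW h0)// mulr_ge0.
have p1 : 7 / 10 * (Lam * h * r) <= S r * (Lam * h * r).
  by rewrite ler_wpM2r// mulr_ge0.
have p0 : 0 <= Lam * h * r by rewrite mulr_ge0.
have e1 : Lam * h * (17 / 12 * r) * (97 / 100 * S r) =
  1649 / 1200 * (S r * (Lam * h * r)) by field.
have e2 : S r * (h * Lam * r) = S r * (Lam * h * r) by ring.
rewrite mulrBl mul1r; rewrite e1 in g1; rewrite e2 in tang.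
lra.
Qed.

End contraction_rate.

(** * Strict contraction of the coupled Euler steps *)
Section coupled_gain.
Variables (R : realType) (q a rh sh : R).
Hypotheses (q0 : 0 < q) (rh_le : rh <= a) (sh0 : 0 < sh).
Local Notation I := (`[0, 2^-1]%classic : set R).

Lemma profile_gain0 w :
  profile q a `|rh + 2 * sh * w| <=
  profile q a rh + slope q a rh * (`|rh + 2 * sh * w| - rh).
Proof. exact: profile_tangent. Qed.

(** The window [- 1/2 <= w <= 0] corresponds to distances between [rh - sh] and
    [rh], which are nonnegative. *)
Lemma profile_gain_far w : sh <= rh ->
  profile q a `|rh + 2 * sh * w| +
    3 / 8 * q * slope q a rh * sh ^+ 2 * (\1_I (- w) * (4 * w ^+ 2)) <=
  profile q a rh + slope q a rh * (`|rh + 2 * sh * w| - rh).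
Proof.
move=> sr; rewrite indicE; case: (boolP (_ \in _)) => [|_]; last first.
  by rewrite mul0r mulr0 addr0 profile_gain0.
rewrite inE/= in_itv/= => /andP[w0 w1]; rewrite mul1r.
have p0 : 0 <= sh * - w by rewrite mulr_ge0// ltW.
have p1 : sh * - w <= sh * 2^-1 by rewrite ler_pM2l.
have v0 : 0 <= rh + 2 * sh * w by move: p1; rewrite mulrN; lra.
rewrite (ger0_norm v0).
have vr : rh + 2 * sh * w <= rh by move: p0; rewrite mulrN; lra.
apply: le_trans (profile_gain_left q0 rh_le vr); rewrite lerD2l.
by rewrite le_eqVlt; apply/orP; left; apply/eqP; ring.
Qed.

(** The window [0 <= w <= 1/2] corresponds to distances between [rh] and
    [rh + sh], half of which have to precede the kink. *)
Lemma profile_gain_near w : 0 <= rh -> sh <= 2 * (a - rh) -> q * sh <= 1 / 4 ->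
  profile q a `|rh + 2 * sh * w| +
    1 / 4 * q * slope q a rh * sh ^+ 2 * (\1_I w * (4 * w ^+ 2)) <=
  profile q a rh + slope q a rh * (`|rh + 2 * sh * w| - rh).
Proof.
move=> rh0 sa qs; rewrite indicE; case: (boolP (_ \in _)) => [|_]; last first.
  by rewrite mul0r mulr0 addr0 profile_gain0.
rewrite inE/= in_itv/= => /andP[w0 w1]; rewrite mul1r.
have u0 : 0 <= 2 * sh * w by rewrite mulr_ge0// mulr_ge0// ltW.
have us : 2 * sh * w <= sh.
  have : sh * w <= sh * 2^-1 by rewrite ler_pM2l.
  by lra.
have e : rh + 2 * sh * w - rh = 2 * sh * w by ring.
rewrite ger0_norm ?addr_ge0//.
have v1 : rh <= rh + 2 * sh * w by rewrite lerDl.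
have v2 : rh + 2 * sh * w - rh <= 2 * (a - rh) by rewrite e (le_trans us).
have v3 : q * (rh + 2 * sh * w - rh) <= 1 / 4.
  by rewrite e; apply: le_trans qs; rewrite ler_pM2l.
apply: le_trans (profile_gain_right q0 rh_le v1 v2 v3); rewrite lerD2l.
by rewrite le_eqVlt; apply/orP; left; apply/eqP; ring.
Qed.

End coupled_gain.

Theorem theorem2p12 (R : realType) (d : nat) (b : 'cV[R]_d -> 'cV[R]_d)
    (J K L Rad : R)
    (hJ : 0 <= J) (hK : 0 < K) (hL : 0 < L) (hRad : 0 < Rad)
    (C1 : forall x y : 'cV[R]_d,
       dotv (x - y) (b x - b y) <= J * enorm (x - y) ^+ 2)
    (C2 : forall x y : 'cV[R]_d, Rad <= enorm (x - y) ->
       dotv (x - y) (b x - b y) <= - K * enorm (x - y) ^+ 2)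
    (C3 : forall x y : 'cV[R]_d,
       enorm (b x - b y) <= L * enorm (x - y)) :
  let h0 := L^-1 *
    Num.min (1 / 6) (Num.min (K / L) (Num.min (1 / 3 * L * Rad ^+ 2)
      (c0 R ^+ 2 / 970 * (L * Rad ^+ 2)^-1))) in
  forall (x y : 'cV[R]_d) (h : R), 0 < h -> h <= h0 ->
  let Lambda := Num.min L (J + L ^+ 2 * h / 2) in
  let r1 := (1 + h * L) * Rad in
  let q := 7 * (c0 R)^-1 * Lambda * Rad in
  let f := fun r : R =>
    \int[lebesgue_measure]_(s in `[0, r]) expR (- (q * Num.min s r1)) in
  let rho := fun u v : 'cV[R]_d => f (enorm (u - v)) in
  let c2 := Num.min (K / 2) (245 / (24 * c0 R) * Lambda ^+ 2 * Rad ^+ 2) *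
    expR (- (49 / (6 * c0 R) * Lambda * Rad ^+ 2)) in
  forall (disp : measure_display) (T : measurableType disp)
    (P : probability T R) (Z : {RV P >-> d.-tuple R}) (U : {RV P >-> R}),
  std_gaussian_vector Z -> uniform01 U -> independent_RV Z U ->
  let X' := fun w : T => coupling_X b h x (col_of_tuple (Z w)) in
  let Y' := fun w : T => coupling_Y b h x y (col_of_tuple (Z w)) (U w) in
  ('E_P[fun w => rho (X' w) (Y' w)] <= ((1 - c2 * h) * rho x y)%:E)%E.
Proof.
move=> h0 x y h h_gt0 h_le Lam r1 q f rho c2 disp T P Z U gaussZ unifU indep; cbv zeta.
have c_gt0 := c0_gt0 R; have c_le4 := c0_le4 R.
have LRad0 : 0 < L * Rad ^+ 2 by rewrite mulr_gt0// exprn_gt0.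
move: h_le; rewrite /h0 ler_pdivlMl// !le_min => /and4P[hL6 hLK hLR hLc].
have h_le_L : h * L <= 1 / 6 by rewrite mulrC.
have h_le_K : h * L ^+ 2 <= K.
  by move: hLK; rewrite ler_pdivlMr// expr2 mulrA (mulrC h).
have h_le_Rad : 3 * h <= Rad ^+ 2.
  rewrite -(ler_pM2l hL).
  rewrite (_ : L * (3 * h) = 3 * (L * h)); last by ring.
  rewrite (_ : L * Rad ^+ 2 = 3 * (1 / 3 * L * Rad ^+ 2)); last by field.
  by rewrite ler_pM2l.
have h_le_c : 970 * (h * L ^+ 2 * Rad ^+ 2) <= c0 R ^+ 2.
  move: hLc; rewrite ler_pdivlMr// => hLc.
  rewrite (_ : h * L ^+ 2 * Rad ^+ 2 = L * h * (L * Rad ^+ 2)); last by ring.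
  by move: hLc; lra.
have Lam_gt0 : 0 < Lam.
  by rewrite lt_min hL ltr_wpDl// divr_gt0// mulr_gt0// exprn_gt0.
have Lam_le_L : Lam <= L by rewrite ge_min lexx.
have q_gt0 : 0 < q by exact: rate_q_gt0.
have Rr1 : Rad <= r1 by exact: Rad_le_r1.
have r1_gt0 : 0 < r1 by exact: lt_le_trans Rr1.
have fE r : 0 <= r -> f r = profile q r1 r.
  by move=> r0; rewrite -(integral_slope q_gt0 (ltW r1_gt0)).
have rhoE : rho x y = profile q r1 (enorm (x - y)) by rewrite /rho fE ?enorm_ge0.
rewrite [leLHS](_ : _ = (\int[P]_t (profile q r1 (coupled_dist Z U b h x y t))%:E)%E);
    last first.
  rewrite unlock; apply: eq_integral => t _.
  by rewrite /rho fE ?enorm_ge0.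
rewrite rhoE {rhoE fE}.
set r := enorm (x - y).
have r0 : 0 <= r by exact: enorm_ge0.
have [xy|xy] := eqVneq (euler_drift b h x) (euler_drift b h y).
  rewrite (eq_integral (cst 0%E)); last first.
    by move=> t _; rewrite /coupled_dist coupled_distance_eq// profile0// ltW.
  rewrite integral0 lee_fin mulr_ge0 ?profile_ge0// ?(ltW r1_gt0)//.
  by rewrite subr_ge0 (@contraction_trivial _ _ K L).
have e_gaussZ := expected_profile_le gaussZ unifU indep h_gt0 q_gt0 (ltW r1_gt0) xy.
set rh := enorm _ in e_gaussZ.
have sh_gt0 : 0 < Num.sqrt h by rewrite sqrtr_gt0.
have sh2 : Num.sqrt h ^+ 2 = h by rewrite sqr_sqrtr// ltW.
have rh_gt0 : 0 < rh by rewrite enorm_gt0// subr_eq0.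
have [Rr|rR] := leP Rad r.
  have rh_le : rh <= (1 - h * K / 2) * r.
    apply: (@drift_dist_le_contractive _ _ _ _ K L) => //.
      exact: lt_le_trans Rr.
    exact: C2.
  apply: (@le_trans _ _ (profile q r1 rh)%:E); last first.
    by rewrite lee_fin; exact: contraction_large.
  have := e_gaussZ set0 0 0 measurable0 (lexx _) (lexx _).
  rewrite mul0r subr0; apply.
    by apply: integral_ge0 => w _; rewrite lee_fin mulr_ge0// rejection_gain_ge0.
  by move=> w; rewrite mul0r addr0; exact: profile_gain0.
have rh_le : rh <= (1 + h * Lam) * r.
  have [h1|h1] := leP L (J + L ^+ 2 * h / 2).
    by rewrite /Lam min_l//; exact: drift_dist_le_lipschitz.
  by rewrite /Lam min_r ?(ltW h1)//; exact: drift_dist_le_onesided.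
have rh_ge : (1 - h * L) * r <= rh.
  by apply: drift_dist_ge => //; apply: le_trans h_le_L _; lra.
have rh_r1 : rh <= r1.
  apply: le_trans rh_le _; apply: ler_pM => //; last exact: ltW.
    by rewrite addr_ge0// mulr_ge0// ltW.
  by rewrite lerD2l ler_pM2l.
have S0 : 0 <= slope q r1 rh by rewrite ltW// slope_gt0.
have k0 k : 0 <= k -> 0 <= k * q * slope q r1 rh * h.
  move=> k0; apply: mulr_ge0; last exact: ltW.
  by apply: mulr_ge0 => //; apply: mulr_ge0 => //; exact: ltW.
have [far|near] := leP (Num.sqrt h) rh.
  pose A := [set w : R | `[0, 2^-1]%classic (- w)].
  have mA : measurable A.
    rewrite -[X in measurable X]setTI.
    by apply: (_ : measurable_fun [set: R] (-%R : R -> R)) => //; exact: measurable_oppr.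
  apply: (@le_trans _ _ (profile q r1 rh - 3 / 8 * q * slope q r1 rh * h * c0 R)%:E).
    apply: (e_gaussZ A) => //.
    - by apply: k0; rewrite divr_ge0.
    - exact: ltW.
    - by apply: far_gain; rewrite ler_pdivlMr// mul1r.
    - by move=> w; rewrite -{2}sh2; exact: profile_gain_far.
  by rewrite lee_fin; apply: contraction_far => //; exact: ltW.
have s1 : rh / Num.sqrt h <= 1 by rewrite ler_pdivrMr// mul1r ltW.
have shR : 17 / 10 * Num.sqrt h <= Rad by exact: sqrt_h_le.
apply: (@le_trans _ _ (profile q r1 rh -
    1 / 4 * q * slope q r1 rh * h * (c0 R * (rh / Num.sqrt h)))%:E).
  (* half of the window precedes the kink since Rad exceeds 1.7 times sqrt h *)
  apply: (e_gaussZ `[0, 2^-1]%classic) => //.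
  - by apply: k0; rewrite divr_ge0.
  - by rewrite mulr_ge0 ?divr_ge0 ?ltW.
  - by apply: near_gain => //; rewrite divr_gt0.
  - move=> w; rewrite -{2}sh2; apply: profile_gain_near => //.
    + exact: ltW.
    + by lra.
    + exact: (@q_sqrt_h_le _ (c0 R) L).
by rewrite lee_fin; apply: (@contraction_near _ _ K L) => //; exact: ltW.
Qed.
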